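(* Let $a,c$ be real numbers with $0<a<1$ and $c\neq 0,-1,-2,\ldots$, and let $\mathcal F=(F_1,F_2)$ be a pair of finite sets of positive integers (not both empty). Assume that $c$ and $\mathcal F$ are admissible. Then the linear combinations of the polynomials $m_n^{a,c;\mathcal F}$, $n\in\sigma_{\mathcal F}$, are dense in $L^2(\omega_{a,c}^{\mathcal F})$, where $\omega_{a,c}^{\mathcal F}$ is the positive measure $$\omega_{a,c}^{\mathcal F}=\sum_{x=0}^\infty\frac{a^x\,\Gamma(x+c+k)}{x!\,\Omega_{\mathcal F}^{a,c}(x)\,\Omega_{\mathcal F}^{a,c}(x+1)}\,\delta_x .$$ Hence $m_n^{a,c;\mathcal F}$, $n\in\sigma_{\mathcal F}$, are exceptional Meixner polynomials, that is, they are orthogonal and complete with respect to a positive measure.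
   Context: $\mathbb N=\{0,1,2,\ldots\}$; $(y)_j=y(y+1)\cdots(y+j-1)$, $(y)_0=1$; $\delta_x$ is the Dirac mass at $x$. Meixner polynomials: for $a\ne 0,1$, $m_n^{a,c}(x)=\frac{a^n}{(1-a)^n}\sum_{j=0}^n a^{-j}\binom{x}{j}\binom{-x-c}{n-j}$. For a pair $\mathcal F=(F_1,F_2)$ of finite sets of positive integers, let $k_i=|F_i|$, $k=k_1+k_2$, $$u_{\mathcal F}=\sum_{f\in F_1}f+\sum_{f\in F_2}f-\binom{k_1+1}{2}-\binom{k_2}{2},\qquad \sigma_{\mathcal F}=\{u_{\mathcal F},u_{\mathcal F}+1,\ldots\}\setminus\{u_{\mathcal F}+f: f\in F_1\}.$$ For $n\in\sigma_{\mathcal F}$, $m_n^{a,c;\mathcal F}(x)$ is the determinant of the $(k+1)\times(k+1)$ matrix with columns indexed by $j=0,1,\ldots,k$ whose rows are, from top to bottom: the row $\big(m_{n-u_{\mathcal F}}^{a,c}(x+j)\big)_j$; then, for each $f\in F_1$ in increasing order, the row $\big(m_f^{a,c}(x+j)\big)_j$; then, for each $f\in F_2$ in increasing order, the row $\big(m_f^{1/a,c}(x+j)/a^j\big)_j$. $\Omega_{\mathcal F}^{a,c}(x)$ is the determinant of the $k\times k$ matrix with columns indexed by $j=0,1,\ldots,k-1$ whose rows are $\big(m_f^{a,c}(x+j)\big)_j$ for $f\in F_1$ (increasing order), followed by $\big(m_f^{1/a,c}(x+j)/a^j\big)_j$ for $f\in F_2$ (increasing order). Admissibility: for $c\neq 0,-1,-2,\ldots$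 put $\hat c=\max\{-[c],0\}$, where $[c]$ is the integral part (floor) of $c$. The number $c$ and the pair $\mathcal F$ are admissible if for all $x\in\mathbb N$ $$\frac{\prod_{f\in F_1}(x-f)\prod_{f\in F_2}(x+c+f)}{(x+c)_{\hat c}}\ge 0 .$$ *)

(* Defs.v *)
From mathcomp Require Import all_boot all_order all_algebra finmap.
From mathcomp Require Import all_classical all_reals all_analysis.

Set Implicit Arguments.
Unset Strict Implicit.
Unset Printing Implicit Defensive.

Import Order.TTheory GRing.Theory Num.Theory.
Import numFieldNormedType.Exports.

Local Open Scope classical_set_scope.
Local Open Scope ring_scope.

Section SpecialFunctions.
Context {R : realType}.
Implicit Types (y z c : R) (j n : nat).

Definition pochhammer y j : R := \prod_(i < j) (y + i%:R).

Definition hatnat z : nat := `|Num.max (- Num.floor z) 0|%N.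

Definition Gamma_int z : R :=
  (\int[lebesgue_measure]_(t in `]0, +oo[) (t `^ (z - 1) * expR (- t)))%R.

(* Real Gamma function: for z > 0 it is the Euler integral ([hatnat z] is 0);
   for z < 0 not an integer, [z + (hatnat z)%:R] lies in ]0, 1[ and the value
   comes from iterating Gamma (z + 1) = z * Gamma z.  Values at the poles
   0, -1, -2, ... are meaningless. *)
Definition Gamma z : R :=
  Gamma_int (z + (hatnat z)%:R) / pochhammer z (hatnat z).

End SpecialFunctions.

Section MeixnerPolynomials.
Context {R : realType}.
Implicit Types (a c : R) (j n : nat).

Definition binpoly (p : {poly R}) j : {poly R} :=
  (j`!%:R)^-1 *: \prod_(i < j) (p - i%:R%:P).

Definition meixner a c n : {poly R} :=
  (a ^+ n / (1 - a) ^+ n) *: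
  \sum_(j < n.+1) a ^- j *: (binpoly 'X j * binpoly (- 'X - c%:P) (n - j)).

Definition shiftpoly (p : {poly R}) j : {poly R} := p \Po ('X + j%:R%:P).

Definition uF (F1 F2 : {fset nat}) : nat :=
  (\sum_(f <- F1) f + \sum_(f <- F2) f
   - 'C(#|` F1|.+1, 2) - 'C(#|` F2|, 2))%N.

Definition sigmaF (F1 F2 : {fset nat}) : set nat :=
  [set n | (uF F1 F2 <= n)%N] `\` [set (uF F1 F2 + f)%N | f in [set` F1]].

(* Entry (i, j) of the k x k matrix defining Omega; [sort leq] lists the
   elements of each set in increasing order. *)
Definition entryF a c (F1 F2 : {fset nat}) (i j : nat) : {poly R} :=
  if (i < #|` F1|)%N
  then shiftpoly (meixner a c (nth 0%N (sort leq F1) i)) j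
  else a ^- j *:
       shiftpoly (meixner a^-1 c (nth 0%N (sort leq F2) (i - #|` F1|))) j.

Definition OmegaF a c (F1 F2 : {fset nat}) : {poly R} :=
  \det (\matrix_(i < #|` F1| + #|` F2|, j < #|` F1| + #|` F2|)
          entryF a c F1 F2 i j).

(* Only meaningful for n in [sigmaF F1 F2]. *)
Definition meixnerF a c (F1 F2 : {fset nat}) n : {poly R} :=
  \det (\matrix_(i < (#|` F1| + #|` F2|).+1, j < (#|` F1| + #|` F2|).+1)
          if val i is i'.+1 then entryF a c F1 F2 i' j
          else shiftpoly (meixner a c (n - uF F1 F2)) j).

Definition admissible c (F1 F2 : {fset nat}) : Prop :=
  forall x : nat,
    0 <= (\prod_(f <- F1) (x%:R - f%:R)) * (\prod_(f <- F2) (x%:R + c + f%:R))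
         / pochhammer (x%:R + c) (hatnat c).

Definition weightF a c (F1 F2 : {fset nat}) (x : nat) : R :=
  a ^+ x * Gamma (x%:R + c + (#|` F1| + #|` F2|)%:R)
  / (x`!%:R * (OmegaF a c F1 F2).[x%:R] * (OmegaF a c F1 F2).[x%:R + 1]).

End MeixnerPolynomials.

Section Orthogonality.
Context {R : realType}.

Definition discrete_measure (w : nat -> {nonneg R}) :
    {measure set (measurableTypeR R) -> \bar R} :=
  mseries (fun x : nat => mscale (w x) \d_(x%:R : measurableTypeR R)) 0.

Implicit Types (mu : {measure set (measurableTypeR R) -> \bar R})
  (I : set nat) (p : nat -> {poly R}).

Definition in_L2 mu I p : Prop :=
  forall n, I n -> (fun x : measurableTypeR R => (p n).[x]) \in Lfun mu 2%:E.

Definition orthogonal_polys mu I p : Prop :=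
  (forall n m, I n -> I m -> n <> m ->
     (\int[mu]_x ((p n).[x] * (p m).[x])%:E = 0)%E) /\
  (forall n, I n -> (\int[mu]_x ((p n).[x] ^+ 2)%:E != 0)%E).

Definition dense_span_L2 mu I p : Prop :=
  forall f : measurableTypeR R -> R, f \in Lfun mu 2%:E ->
  forall eps : R, 0 < eps ->
  exists (s : seq nat) (b : nat -> R),
    [set` s] `<=` I /\
    ('N[mu]_(2%:E)[EFin \o (fun x => f x - (\sum_(n <- s) b n *: p n).[x])%R]
       < eps%:E)%E.

End Orthogonality.

(* Main.v *)
Require Import Defs.
From mathcomp Require Import all_boot all_order all_algebra finmap.
From mathcomp Require Import all_classical all_reals all_analysis.
From mathcomp Require Import measurable_realfun ring lra zify.

(* Up to nonzero factors, the Meixner polynomials and the seed functions are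
   values of one family [K_x(n)], symmetric in [n] and [x], at the integers [n]
   and at the nodes [f] (f in F1) and [- c - f] (f in F2).  Read as functions of
   [n], the determinants [m^F_{u+n}(x)] are therefore Christoffel's formula for
   the polynomials [R_x] orthogonal with respect to the Krall-Meixner weight
   [prod_(f in F1) (n - f) prod_(f in F2) (n + c + f) a^n (c)_n / n!], and
   admissibility says that this weight has constant sign.  This gives
   [Omega(x) != 0], and the exceptional weight at [x] is a positive constant
   times [|R_x|^-2], up to the row scaling of the determinants.  Polynomials are
   dense for the Krall-Meixner weight because it is dominated by a Meixner
   weight, for which density is self-duality.  So the matrix [R_x(n)], suitably
   scaled, is unitary: orthogonality and completeness in [n] of the rows give
   orthogonality and completeness in [x] of the columns. *)

Set Implicit Arguments.
Unset Strict Implicit.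
Unset Printing Implicit Defensive.

Import Order.TTheory GRing.Theory Num.Theory.
Import numFieldNormedType.Exports.
Local Open Scope classical_set_scope.
Local Open Scope ring_scope.

(** * Meixner polynomials and their duality *)

(** For [c < 0] the factor [(c)_n] takes both signs, so the Meixner orthogonality and Christoffel's
    formula are proved for the linear functional [momentfun], which asks for no positivity;
    positivity enters with the Krall-Meixner weight, after division by [(c)_hat c]. The product
    [Omega(x) Omega(x + 1)] in the exceptional weight comes from the norm of [R_x]: its leading
    coefficient carries the Casorati determinant at [x], while pairing with a polynomial of degree
    at most [x] leaves only the first term of Christoffel's expansion, whose coefficient is the
    determinant at [x + 1]. The nodes [- c - f] are never natural numbers, so on the natural numbers
    the Krall-Meixner weight vanishes exactly on [F1]: these are the indices that [sigmaF] removes.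
    Density of polynomials is used only for indicators of points: approximating the indicator of [n]
    and evaluating at [m] gives the dual orthogonality relation. *)

Definition falling {R : realType} (y : R) (j : nat) : R :=
  \prod_(i < j) (y - i%:R).

Section Factorials.
Context {R : realType}.
Implicit Types (y w b : R) (i j n : nat).

Lemma falling0 y : falling y 0 = 1.
Proof. by rewrite /falling big_ord0. Qed.

Lemma fallingS y j : falling y j.+1 = falling y j * (y - j%:R).
Proof. by rewrite /falling big_ord_recr. Qed.

Lemma fallingSl y j : falling y j.+1 = y * falling (y - 1) j.
Proof.
rewrite /falling big_ord_recl /= subr0; congr (_ * _).
by apply: eq_bigr => i _; rewrite /= /bump /= natrD opprD addrA.
Qed.

Lemma falling_nat n j : falling n%:R j = (n ^_ j)%:R :> R.
Proof.
elim: j => [|j IHj]; first by rewrite falling0 ffactn0.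
rewrite fallingS IHj ffactnSr natrM; have [jn|nj] := leqP j n.
  by rewrite natrB.
by rewrite ffact_small // !mul0r.
Qed.

Lemma pochhammer0 y : pochhammer y 0 = 1.
Proof. by rewrite /pochhammer big_ord0. Qed.

Lemma pochhammerS y j : pochhammer y j.+1 = pochhammer y j * (y + j%:R).
Proof. by rewrite /pochhammer big_ord_recr. Qed.

Lemma pochhammerD y i j :
  pochhammer y (i + j) = pochhammer y i * pochhammer (y + i%:R) j.
Proof.
elim: j => [|j IHj]; first by rewrite addn0 pochhammer0 mulr1.
by rewrite addnS !pochhammerS IHj natrD !mulrA addrA.
Qed.

Lemma pochhammerSl y j : pochhammer y j.+1 = y * pochhammer (y + 1) j.
Proof. by rewrite -add1n pochhammerD pochhammerS pochhammer0 mul1r addr0. Qed.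

Lemma falling_opp y j : falling (- y) j = (-1) ^+ j * pochhammer y j.
Proof.
elim: j => [|j IHj]; first by rewrite falling0 pochhammer0 mul1r.
by rewrite fallingS pochhammerS IHj exprS; ring.
Qed.

Lemma pochhammer_neq0 y j : (forall m, y != - m%:R) -> pochhammer y j != 0.
Proof.
by move=> y_np; apply/prodf_neq0 => i _; rewrite addr_eq0 y_np.
Qed.

Lemma pochhammer_gt0 y j : 0 < y -> 0 < pochhammer y j.
Proof. by move=> y0; apply: prodr_gt0 => i _; rewrite ltr_wpDr. Qed.

Lemma fact_neq0 n : n`!%:R != 0 :> R.
Proof. by rewrite pnatr_eq0 -lt0n fact_gt0. Qed.

(** Pascal's rule as the induction step for binomial sums. The summand sees [j] and [n - j]
    separately, so that each half of the rule shifts only one argument. *)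
Lemma sum_bin_pascal (F : nat -> nat -> R) n :
  \sum_(j < n.+2) 'C(n.+1, j)%:R * F j (n.+1 - j)%N =
  \sum_(j < n.+1) 'C(n, j)%:R * (F j.+1 (n - j)%N + F j (n - j).+1).
Proof.
rewrite big_ord_recl /= bin0 subn0.
under eq_bigr => j _ do
  rewrite /bump /= add1n binS natrD mulrDl subSS.
rewrite big_split /=.
under [RHS]eq_bigr => j _ do rewrite mulrDr.
rewrite [RHS]big_split /= [RHS]addrC addrA; congr (_ + _).
rewrite [RHS]big_ord_recl /= bin0 subn0; congr (_ + _).
rewrite big_ord_recr /= bin_small // mul0r addr0.
apply: eq_bigr => j _; rewrite /bump /= add1n; congr (_ * F _ _).
by rewrite subnSK.
Qed.

(* For [b = 1] this is the Chu-Vandermonde identity. *)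
Lemma vandermonde_gen b y w n :
  \sum_(j < n.+1) 'C(n, j)%:R * (b ^+ j * falling y j * falling w (n - j)) =
  \sum_(j < n.+1) 'C(n, j)%:R *
    ((b - 1) ^+ j * falling y j * falling (y + w - j%:R) (n - j)).
Proof.
elim: n y w => [|n IHn] y w.
  by rewrite !big_ord_recl !big_ord0 /= !falling0 !expr0.
rewrite (sum_bin_pascal (fun j m => b ^+ j * falling y j * falling w m)).
rewrite (sum_bin_pascal
  (fun j m => (b - 1) ^+ j * falling y j * falling (y + w - j%:R) m)).
(* Removing the first factor of a falling factorial turns the two halves into the same sum for
   [(y - 1, w)] and for [(y, w - 1)]; the induction hypothesis applies to both. *)
transitivity (b * y *
    \sum_(j < n.+1) 'C(n, j)%:R *
      (b ^+ j * falling (y - 1) j * falling w (n - j)) +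
  w * \sum_(j < n.+1) 'C(n, j)%:R *
      (b ^+ j * falling y j * falling (w - 1) (n - j))).
  rewrite !mulr_sumr -big_split /=; apply: eq_bigr => j _.
  by rewrite [falling y _.+1]fallingSl [falling w _.+1]fallingSl exprS; ring.
rewrite !IHn !mulr_sumr -big_split /=; apply: eq_bigr => j _.
rewrite [falling (y + w - _) _.+1]fallingSl.
have -> : y + w - j.+1%:R = y + w - j%:R - 1 by rewrite -natr1; ring.
have -> : y - 1 + w - j%:R = y + w - j%:R - 1 by ring.
have -> : y + (w - 1) - j%:R = y + w - j%:R - 1 by ring.
rewrite exprS fallingS.
have E : y * falling (y - 1) j = falling y j * (y - j%:R).
  by rewrite -fallingSl fallingS.
set f := falling (_ - 1) (n - j); set g := falling (y - 1) j in E *.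
transitivity ('C(n, j)%:R * (b - 1) ^+ j * f *
  (b * (y * g) + w * falling y j)); first by ring.
rewrite E; ring.
Qed.

(* The [i]-th finite difference of a monic polynomial of degree [j <= i]. *)
Lemma alternating_sum_pochhammer y i j : (j <= i)%N ->
  \sum_(l < i.+1) 'C(i, l)%:R * ((-1) ^+ l * pochhammer (y + l%:R) j) =
  if j == i then (-1) ^+ i * i`!%:R else 0.
Proof.
elim: i y j => [|i IHi] y j ji.
  move: ji; rewrite leqn0 => /eqP ->; rewrite big_ord_recl big_ord0 /=.
  by rewrite pochhammer0 bin0 fact0 addr0 !mulr1.
rewrite (sum_bin_pascal (fun l _ => (-1) ^+ l * pochhammer (y + l%:R) j)).
case: j ji => [|j] ji.
  by apply: big1 => l _; rewrite !pochhammer0 exprS; ring.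
transitivity (- j.+1%:R * \sum_(l < i.+1) 'C(i, l)%:R *
   ((-1) ^+ l * pochhammer (y + 1 + l%:R) j)); last first.
  rewrite IHi // eqSS; case: eqP => [->|_]; last by rewrite mulr0.
  by rewrite factS natrM exprS; ring.
rewrite mulr_sumr; apply: eq_bigr => l _.
rewrite [pochhammer (y + l%:R) _]pochhammerSl pochhammerS.
have -> : y + l.+1%:R = y + 1 + l%:R by rewrite -natr1; ring.
have -> : y + l%:R + 1 = y + 1 + l%:R by ring.
by rewrite exprS -natr1; ring.
Qed.

End Factorials.

(* The Meixner polynomial [2F1(-n, -X; c; 1 - 1/a)], normalised so that it is
   symmetric in [n] and [X] on the natural numbers. *)
Definition dualmeixner {R : realType} (a c : R) (n : nat) : {poly R} :=
  \sum_(j < n.+1) ('C(n, j)%:R * (1 - a^-1) ^+ j / pochhammer c j) *: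
     \prod_(i < j) ('X - i%:R%:P).

Section DualMeixner.
Context {R : realType} (a c : R).
Hypotheses (a_neq0 : a != 0) (a_neq1 : a != 1) (c_np : forall m, c != - m%:R).
Let aB1 : a - 1 != 0. Proof. by rewrite subr_eq0. Qed.
Let Ba1 : 1 - a != 0. Proof. by rewrite subr_eq0 eq_sym. Qed.

Lemma dualmeixnerE n y : (dualmeixner a c n).[y] =
  \sum_(j < n.+1)
    'C(n, j)%:R * (1 - a^-1) ^+ j / pochhammer c j * falling y j.
Proof.
rewrite /dualmeixner horner_sum; apply: eq_bigr => j _.
rewrite hornerZ horner_prod; congr (_ * _).
by apply: eq_bigr => i _; rewrite !hornerE.
Qed.

(** ['C(n, j)] times the falling factorial of [x] is ['C(n, j) 'C(x, j) j!], symmetric in [n] and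
    [x]. Both sums are first extended to [j <= n + x], where the added binomials vanish. *)
Lemma dualmeixner_sym n x :
  (dualmeixner a c n).[x%:R] = (dualmeixner a c x).[n%:R].
Proof.
have wide p q : (dualmeixner a c p).[q%:R] = \sum_(j < (p + q).+1)
    'C(p, j)%:R * (1 - a^-1) ^+ j / pochhammer c j * falling q%:R j.
  rewrite dualmeixnerE; have pq : (p.+1 <= (p + q).+1)%N by rewrite ltnS leq_addr.
  rewrite (big_ord_widen _
    (fun j => 'C(p, j)%:R * (1 - a^-1) ^+ j / pochhammer c j * falling q%:R j) pq).
  rewrite big_mkcond; apply: eq_bigr => j _.
  by rewrite ltnS; case: leqP => // pj; rewrite bin_small // !mul0r.
rewrite !wide (addnC x); apply: eq_bigr => j _; rewrite !falling_nat.
rewrite -!bin_ffact !natrM; ring.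
Qed.

Lemma size_falling_poly j : size (\prod_(i < j) ('X - i%:R%:P : {poly R})) = j.+1.
Proof. by rewrite size_prod_XsubC /index_enum -enumT size_enum_ord. Qed.

Lemma lead_coef_dualmeixner_neq0 n : (1 - a^-1) ^+ n / pochhammer c n != 0.
Proof.
rewrite mulf_neq0 ?invr_neq0 ?pochhammer_neq0 // expf_neq0 //.
by rewrite subr_eq0 eq_sym invr_eq1.
Qed.

Lemma coef_dualmeixner n : (dualmeixner a c n)`_n = (1 - a^-1) ^+ n / pochhammer c n.
Proof.
rewrite /dualmeixner big_ord_recr /= coefD coefZ binn mul1r.
have -> : (\prod_(i < n) ('X - i%:R%:P) : {poly R})`_n = 1.
  have := monic_prod_XsubC (index_enum 'I_n) predT (fun i : 'I_n => i%:R : R).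
  by rewrite monicE lead_coefE size_falling_poly => /eqP.
rewrite mulr1 coef_sum big1 ?add0r // => j _.
by rewrite coefZ [X in _ * X]nth_default ?mulr0 // size_falling_poly.
Qed.

Lemma size_dualmeixner n : size (dualmeixner a c n) = n.+1.
Proof.
apply/eqP; rewrite eqn_leq; apply/andP; split.
  apply: (leq_trans (size_sum _ _ _)); apply/bigmax_leqP => j _.
  by apply: (leq_trans (size_scale_leq _ _)); rewrite size_falling_poly.
rewrite ltnNge; apply/negP => sz.
have /eqP := coef_dualmeixner n; rewrite nth_default // eq_sym; apply/negP.
exact: lead_coef_dualmeixner_neq0.
Qed.

Lemma horner_meixner n y : (meixner a c n).[y] =
  a ^+ n / (1 - a) ^+ n * \sum_(j < n.+1) a ^- j *
    (falling y j / j`!%:R * (falling (- y - c) (n - j) / (n - j)`!%:R)).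
Proof.
rewrite /meixner hornerZ horner_sum; congr (_ * _); apply: eq_bigr => j _.
have binE p m : (binpoly p m).[y] = falling p.[y] m / m`!%:R.
  rewrite /binpoly hornerZ horner_prod mulrC; congr (_ / _).
  by apply: eq_bigr => i _; rewrite !hornerE.
by rewrite hornerZ hornerM !binE !hornerE.
Qed.

(** This is [vandermonde_gen] with [b = 1/a] and [w = - y - c]: then [y + w - j = - (c + j)] is free
    of [y], and the second falling factorial becomes the constant [(c + j)_(n - j)] up to sign. *)
Lemma meixner_dualE n y : (meixner a c n).[y] =
  (a / (a - 1)) ^+ n * pochhammer c n / n`!%:R * (dualmeixner a c n).[y].
Proof.
rewrite horner_meixner.
have -> : \sum_(j < n.+1) a ^- j *
    (falling y j / j`!%:R * (falling (- y - c) (n - j) / (n - j)`!%:R)) =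
  n`!%:R^-1 * \sum_(j < n.+1) 'C(n, j)%:R *
    (a^-1 ^+ j * falling y j * falling (- y - c) (n - j)).
  rewrite mulr_sumr; apply: eq_bigr => j _.
  have jn : (j <= n)%N by rewrite -ltnS.
  have := bin_fact jn => /(congr1 (fun m => m%:R : R)); rewrite !natrM => <-.
  have C0 : 'C(n, j)%:R != 0 :> R by rewrite pnatr_eq0 -lt0n bin_gt0.
  by rewrite exprVn; field; rewrite expf_neq0 // C0 !fact_neq0.
rewrite vandermonde_gen dualmeixnerE !mulr_sumr; apply: eq_bigr => j _.
have jn : (j <= n)%N by rewrite -ltnS.
have -> : y + (- y - c) - j%:R = - (c + j%:R) by ring.
rewrite falling_opp -[in pochhammer c n](subnKC jn) pochhammerD.
have -> : (a / (a - 1)) ^+ n = a ^+ n / (1 - a) ^+ n * (-1) ^+ n.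
  rewrite -expr_div_n -exprMn; congr (_ ^+ _); field.
  by rewrite ?a_neq0 ?aB1 ?Ba1.
have -> : (1 - a^-1) ^+ j = (-1) ^+ j * (a^-1 - 1) ^+ j.
  by rewrite -exprMn; congr (_ ^+ _); ring.
have -> : (-1) ^+ n = (-1) ^+ (n - j) * (-1) ^+ j :> R by rewrite -exprD subnK.
have sgn : (-1) ^+ j * (-1) ^+ j = 1 :> R by rewrite -exprMn mulrNN mulr1 expr1n.
rewrite -[LHS]mul1r -{1}sgn.
have p0 := @pochhammer_neq0 _ _ j c_np; have f0 := fact_neq0 n.
have an : (1 - a) ^+ n != 0 by rewrite expf_neq0.
move: sgn an p0 f0; set s := (-1) ^+ j; set t := (-1) ^+ (n - j).
set d := (1 - a) ^+ n; set e := (a^-1 - 1) ^+ j; set f := n`!%:R.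
move=> _ an p0 f0; field; by rewrite p0 f0 an.
Qed.

End DualMeixner.

Section Seeds.
Context {R : realType} (a c : R).
Hypotheses (a_neq0 : a != 0) (a_neq1 : a != 1) (c_np : forall m, c != - m%:R).
Let aB1 : a - 1 != 0. Proof. by rewrite subr_eq0. Qed.
Let Ba1 : 1 - a != 0. Proof. by rewrite subr_eq0 eq_sym. Qed.

(** The substitution exchanges the two binomials of the definition; reversing the summation puts
    them back and turns powers of [1/a] into powers of [a]. *)
Lemma meixner_reflect n y :
  (meixner a^-1 c n).[- y - c] = (-1) ^+ n * (meixner a c n).[y].
Proof.
rewrite !horner_meixner.
have -> : - (- y - c) - c = y by ring.
rewrite mulrA [X in _ * X](reindex_inj rev_ord_inj) /=.
rewrite !mulr_sumr; apply: eq_bigr => j _; rewrite subSS.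
have jn : (j <= n)%N by rewrite -ltnS.
rewrite subKn //.
have -> : (1 - a^-1) ^+ n = (-1) ^+ n * (1 - a) ^+ n / a ^+ n.
  rewrite -exprMn -expr_div_n; congr (_ ^+ _); field; exact: a_neq0.
have -> : a^-1 ^- (n - j) = a ^+ n / a ^+ j.
  by rewrite exprVn invrK -[in a ^+ n](subnK jn) exprD mulfK // expf_neq0.
have sgn : (-1) ^+ n * (-1) ^+ n = 1 :> R by rewrite -exprMn mulrNN mulr1 expr1n.
have sgn0 : (-1) ^+ n != 0 :> R by rewrite expf_neq0 // oppr_eq0 oner_eq0.
have a1n : (1 - a) ^+ n != 0 by rewrite expf_neq0 // subr_eq0 eq_sym.
have an : a ^+ n != 0 by rewrite expf_neq0.
have aj : a ^+ j != 0 by rewrite expf_neq0.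
rewrite exprVn.
have -> : ((-1) ^+ n * (1 - a) ^+ n / a ^+ n)^-1 = (-1) ^+ n * (a ^+ n / (1 - a) ^+ n).
  rewrite -[LHS]mul1r -{1}sgn; field; by rewrite sgn0 a1n an.
field; by rewrite !fact_neq0 a1n an aj.
Qed.

(** This places the [F2] seeds in the family [K_x]: reflection in degree [x] trades the parameter
    [1/a] at [f] for [a] at [- c - f], and self-duality for [1/a] exchanges [f] and [x]. *)
Lemma meixner_inv_dualE f x : (meixner a^-1 c f).[x%:R] =
  a ^+ x * ((1 - a) ^- f * pochhammer c f / f`!%:R) * (dualmeixner a c x).[- c - f%:R].
Proof.
have ai0 : a^-1 != 0 by rewrite invr_eq0.
have ai1 : a^-1 != 1 by rewrite invr_eq1.
have R1 : (meixner a^-1 c x).[f%:R] = (-1) ^+ x * (meixner a c x).[- c - f%:R].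
  rewrite -meixner_reflect //; congr (_.[_]); ring.
rewrite meixner_dualE // in R1; rewrite meixner_dualE // in R1.
rewrite meixner_dualE // dualmeixner_sym //.
have E : a^-1 / (a^-1 - 1) = (1 - a)^-1.
  by field; rewrite ?a_neq0 ?aB1 ?Ba1.
rewrite E in R1 *.
have px : pochhammer c x / x`!%:R != 0.
  by rewrite mulf_neq0 ?invr_neq0 ?pochhammer_neq0 ?fact_neq0.
have ax : (1 - a)^-1 ^+ x != 0.
  by rewrite expf_neq0 // invr_neq0 // subr_eq0 eq_sym.
have A : (-1) ^+ x * (a / (a - 1)) ^+ x = a ^+ x * (1 - a)^-1 ^+ x.
  rewrite -!exprMn; congr (_ ^+ _); field; by rewrite ?a_neq0 ?aB1 ?Ba1.
have -> : (dualmeixner a^-1 c x).[f%:R] = a ^+ x * (dualmeixner a c x).[- c - f%:R].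
  apply: (mulfI (mulf_neq0 ax px)); rewrite !mulrA in R1 *; rewrite R1.
  by rewrite A; ring.
rewrite exprVn; ring.
Qed.

End Seeds.

(** * Moment functionals and Meixner orthogonality *)

(** Geometric decay serves as the summability condition because it survives multiplication by any
    polynomial, so that all moments converge. *)
Definition expdecay {R : realType} (u : nat -> R) : Prop :=
  exists C r, [/\ 0 <= C, 0 <= r, r < 1 & forall n, `|u n| <= C * r ^+ n].

Definition nsum {R : realType} (u : nat -> R) : R := limn (series u).

Section Decay.
Context {R : realType}.
Implicit Types (u v : nat -> R) (p q : {poly R}).

Lemma expdecay_le u v D : 0 <= D -> expdecay u ->
  (forall n, `|v n| <= D * `|u n|) -> expdecay v.
Proof.
move=> D0 [C [r [C0 r0 r1 ur]]] vu; exists (D * C), r; split=> // [|n].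
  exact: mulr_ge0.
by apply: (le_trans (vu n)); rewrite -mulrA ler_wpM2l.
Qed.

Lemma expdecayD u v : expdecay u -> expdecay v -> expdecay (fun n => u n + v n).
Proof.
move=> [C [r [C0 r0 r1 ur]]] [D [s [D0 s0 s1 vs]]].
exists (C + D), (Num.max r s); split => [|||n].
- exact: addr_ge0.
- by rewrite le_max r0.
- by rewrite gt_max r1.
apply: (le_trans (ler_normD _ _)); rewrite mulrDl; apply: lerD.
  apply: (le_trans (ur n)); rewrite ler_wpM2l // lerXn2r ?nnegrE ?le_max ?r0 //.
  by rewrite lexx.
apply: (le_trans (vs n)); rewrite ler_wpM2l // lerXn2r ?nnegrE ?le_max ?r0 //.
by rewrite lexx orbT.
Qed.

(** Bernoulli's inequality for the powers of [s^-1 = 1 + (s^-1 - 1)]. *)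
Lemma natr_expr_le (s : R) n : 0 < s -> s < 1 -> n%:R * s ^+ n <= (s^-1 - 1)^-1.
Proof.
move=> s0 s1; have h0 : 0 < s^-1 - 1 by rewrite subr_gt0 invf_gt1.
have bern m : 1 + m%:R * (s^-1 - 1) <= s^-1 ^+ m.
  elim: m => [|m IHm]; first by rewrite mul0r addr0 expr0.
  rewrite exprS; apply: (@le_trans _ _ (s^-1 * (1 + m%:R * (s^-1 - 1)))).
    rewrite -subr_ge0 -natr1 [leRHS](_ : _ = m%:R * (s^-1 - 1) ^+ 2); last by ring.
    by rewrite mulr_ge0 // sqr_ge0.
  by rewrite ler_wpM2l // invr_ge0 ltW.
rewrite -[leRHS]mul1r ler_pdivlMr // mulrAC -ler_pdivlMr ?exprn_gt0 //.
rewrite mul1r -exprVn; apply: le_trans (bern n); lra.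
Qed.

Lemma expdecayMn u : expdecay u -> expdecay (fun n => n%:R * u n).
Proof.
move=> [C [r [C0 r0 r1 ur]]].
(* A ratio strictly between [r] and [1]: [n (r / s)^n] stays bounded and [s^n] keeps the decay. The
   bound needs [0 < r / s]; for [r = 0] only [u 0] can be nonzero, and the factor [n] kills it. *)
pose s := (1 + r) / 2; have s0 : 0 < s by rewrite /s; lra.
have s1 : s < 1 by rewrite /s; lra.
have rs : r / s < 1.
  by rewrite ltr_pdivrMr // mul1r /s; lra.
have [r_eq0|r_neq0] := eqVneq r 0.
  exists 0, 0; split => // n; rewrite mul0r normrM; move: (ur n).
  rewrite r_eq0; case: n => [|n]; first by rewrite normr0 mul0r.
  by rewrite expr0n mulr0 normr_le0 => /eqP ->; rewrite normr0 mulr0.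
have rs0 : 0 < r / s by rewrite divr_gt0 // lt_neqAle eq_sym r_neq0.
exists (C * (((r / s)^-1 - 1)^-1)), s; split => // [||n].
- by rewrite mulr_ge0 // invr_ge0 subr_ge0 invf_ge1 // ltW.
- exact: ltW.
rewrite normrM ger0_norm //.
apply: (@le_trans _ _ (n%:R * (C * r ^+ n))); first by rewrite ler_wpM2l.
rewrite (_ : r ^+ n = (r / s) ^+ n * s ^+ n); last first.
  by rewrite -exprMn divfK // gt_eqF.
rewrite !mulrA [n%:R * C]mulrC -[C * n%:R * _]mulrA.
by rewrite ler_wpM2r ?exprn_ge0 ?(ltW s0) // ler_wpM2l // natr_expr_le.
Qed.

Lemma expdecayZ k u : expdecay u -> expdecay (fun n => k * u n).
Proof. by move=> du; apply: (@expdecay_le u _ `|k|) => // n; rewrite normrM. Qed.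

Lemma expdecay_poly p u : expdecay u -> expdecay (fun n => p.[n%:R] * u n).
Proof.
move=> du; elim/poly_ind: p => [|p k IHp].
  rewrite (_ : (fun n => (0 : {poly R}).[n%:R] * u n) = fun n => 0 * u n).
    exact: expdecayZ.
  by apply/funext => n; rewrite horner0.
rewrite (_ : (fun n => (p * 'X + k%:P).[n%:R] * u n) =
  fun n => n%:R * (p.[n%:R] * u n) + k * u n); last first.
  by apply/funext => n; rewrite hornerD hornerMX hornerC; ring.
by apply: expdecayD; [exact: expdecayMn|exact: expdecayZ].
Qed.

Lemma expdecay_cvg u : expdecay u -> cvgn (series u).
Proof.
move=> [C [r [C0 r0 r1 ur]]]; apply: normed_cvg.
apply: (@series_le_cvg _ _ (geometric C r)) => [n|n|n|].
- exact: normr_ge0.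
- exact: geometric_ge0.
- exact: ur.
by apply: is_cvg_geometric_series; rewrite ger0_norm.
Qed.

Lemma nsumD u v : cvgn (series u) -> cvgn (series v) ->
  nsum (fun n => u n + v n) = nsum u + nsum v.
Proof. by move=> cu cv; rewrite /nsum -lim_seriesD. Qed.

Lemma nsumZ k u : cvgn (series u) -> nsum (fun n => k * u n) = k * nsum u.
Proof. by move=> cu; exact: (lim_seriesZ k cu). Qed.

Lemma nsum_ge_term u n : cvgn (series u) -> (forall n, 0 <= u n) ->
  u n <= nsum u.
Proof.
move=> cu u0; apply: (@le_trans _ _ (series u n.+1)).
  by rewrite seriesSr lerDr sumr_ge0.
apply: nondecreasing_cvgn_le => //; apply: nondecreasing_series => *; exact: u0.
Qed.

Lemma nsumS u : cvgn (series u) -> nsum u = u 0%N + nsum (fun n => u n.+1).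
Proof.
move=> cu; apply/esym; have E n : series u n.+1 = u 0%N + series (fun n => u n.+1) n.
  by rewrite !seriesEord /= big_ord_recl.
have cS : series u n.+1 @[n --> \oo] --> nsum u by rewrite cvg_shiftS.
have c' : series (fun n => u n.+1) @ \oo --> nsum u - u 0%N.
  rewrite (_ : series _ = fun n => series u n.+1 - u 0%N).
    by apply: cvgB => //; exact: cvg_cst.
  by apply/funext => n; rewrite E addrC addKr.
by rewrite /nsum in c' *; rewrite (cvg_lim _ c') // addrC subrK.
Qed.

Lemma nsum_shift u l : expdecay u -> (forall n, (n < l)%N -> u n = 0) ->
  nsum u = nsum (fun n => u (n + l)%N).
Proof.
elim: l u => [|l IHl] u du u0.
  by congr nsum; apply/funext => n; rewrite addn0.
rewrite nsumS ?u0 ?add0r //; last exact: expdecay_cvg.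
rewrite IHl; first by congr nsum; apply/funext => n; rewrite addnS.
- case: du => C [r [C0 r0 r1 ur]]; exists (C * r), r; split => // [|n].
    exact: mulr_ge0.
  by rewrite -mulrA -exprS.
- by move=> n nl; rewrite u0.
Qed.

End Decay.

Definition momentfun {R : realType} (u : nat -> R) (p : {poly R}) : R :=
  nsum (fun n => p.[n%:R] * u n).

Section MomentFunctional.
Context {R : realType} (u : nat -> R).
Hypothesis u_decay : expdecay u.
Implicit Types (p q : {poly R}).

Local Notation L := (momentfun u).

Lemma momentfun_cvg p : cvgn (series (fun n => p.[n%:R] * u n)).
Proof. exact/expdecay_cvg/expdecay_poly. Qed.

Lemma momentfunD p q : L (p + q) = L p + L q.
Proof.
rewrite /momentfun -nsumD; try exact: momentfun_cvg.
by congr nsum; apply/funext => n; rewrite hornerD mulrDl.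
Qed.

Lemma momentfunZ k p : L (k *: p) = k * L p.
Proof.
rewrite /momentfun -nsumZ; last exact: momentfun_cvg.
by congr nsum; apply/funext => n; rewrite hornerZ mulrA.
Qed.

Lemma momentfun0 : L 0 = 0.
Proof. by rewrite -(scale0r 0) momentfunZ mul0r. Qed.

Lemma momentfun_sum (I : Type) (r : seq I) (P : pred I) (F : I -> {poly R}) :
  L (\sum_(i <- r | P i) F i) = \sum_(i <- r | P i) L (F i).
Proof. exact: (big_morph _ momentfunD momentfun0). Qed.

Lemma momentfun_sqr_gt0 p q n : (forall m, 0 <= q.[m%:R] * u m) ->
  0 < q.[n%:R] * u n -> p.[n%:R] != 0 -> 0 < L (p * p * q).
Proof.
have E m : (p * p * q).[m%:R] * u m = p.[m%:R] ^+ 2 * (q.[m%:R] * u m).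
  by rewrite !hornerM; ring.
move=> qu qn pn; apply: (@lt_le_trans _ _ ((p * p * q).[n%:R] * u n)).
  have p2 : 0 < p.[n%:R] ^+ 2 by rewrite exprn_even_gt0.
  by rewrite E mulr_gt0.
apply: nsum_ge_term; first exact: momentfun_cvg.
by move=> m; rewrite E mulr_ge0 ?sqr_ge0.
Qed.

End MomentFunctional.

Lemma momentfun_weightM {R : realType} (u : nat -> R) (p q : {poly R}) :
  momentfun (fun n => p.[n%:R] * u n) q = momentfun u (p * q).
Proof.
rewrite /momentfun; congr nsum; apply/funext => n.
by rewrite hornerM; ring.
Qed.

Section GradedBasis.
Context {R : realType} (B : nat -> {poly R}).
Hypothesis sizeB : forall j, size (B j) = j.+1.

Lemma graded_basis_span m (q : {poly R}) : (size q <= m)%N ->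
  exists b : nat -> R, q = \sum_(j < m) b j *: B j.
Proof.
elim: m q => [|m IHm] q szq.
  exists (fun=> 0); rewrite big_ord0; apply/eqP.
  by rewrite -size_poly_eq0 -leqn0.
have lB : (B m)`_m != 0.
  have : lead_coef (B m) != 0 by rewrite lead_coef_eq0 -size_poly_gt0 sizeB.
  by rewrite lead_coefE sizeB.
have [|b qE] := IHm (q - (q`_m / (B m)`_m) *: B m).
  apply/leq_sizeP => j; rewrite leq_eqVlt => /predU1P[<-|mj].
    by rewrite coefB coefZ divfK // subrr.
  rewrite coefB coefZ (nth_default _ (leq_trans szq mj)).
  have -> : (B m)`_j = 0 by rewrite nth_default ?sizeB.
  by rewrite mulr0 subrr.
exists (fun j => if (j < m)%N then b j else q`_m / (B m)`_m).
rewrite big_ord_recr /= ltnn.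
under eq_bigr => j _ do rewrite ltn_ord.
by rewrite -qE subrK.
Qed.

End GradedBasis.

(** The classical weight [a^n Gamma(n + c) / n!] divided by [Gamma c], so that the Gamma function is
    confined to the comparison with [weightF]. *)
Definition meixnerw {R : realType} (a c : R) (n : nat) : R :=
  a ^+ n * pochhammer c n / n`!%:R.

Section MeixnerWeight.
Context {R : realType} (a : R).
Hypotheses (a_gt0 : 0 < a) (a_lt1 : a < 1).
Implicit Types (c : R).

Lemma pochhammer_ge0 (y : R) n : 0 <= y -> 0 <= pochhammer y n.
Proof. by move=> y0; apply: prodr_ge0 => i _; rewrite addr_ge0. Qed.

(** Since [n (K)_n <= K (K + 1)_n], each factor [X] of the polynomial is paid for by raising the
    Pochhammer parameter by one. *)
Lemma poly_pochhammer_le (p : {poly R}) c : exists K C, [/\ (0 < K)%N, 0 < C &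
  forall n, `|p.[n%:R] * pochhammer c n| <= C * pochhammer K%:R n].
Proof.
have [K0 K0c] : exists K0 : nat, `|c| <= K0.+1%:R.
  by exists (Num.truncn `|c|); rewrite ltW // truncnS_gt.
have base n : `|pochhammer c n| <= pochhammer K0.+1%:R n.
  rewrite normr_prod; apply: ler_prod => i _; rewrite normr_ge0 /=.
  by apply: (le_trans (ler_normD _ _)); rewrite lerD // ger0_norm.
elim/poly_ind: p => [|p d [K [C [K0' C0 pK]]]].
  exists K0.+1, 1; split => // n.
  by rewrite horner0 mul0r normr0 mul1r pochhammer_ge0.
have mono (i j : nat) n : pochhammer i%:R n <= pochhammer (i + j)%:R n :> R.
  apply: ler_prod => l _; rewrite addr_ge0 //=.
  by rewrite lerD2r ler_nat leq_addr.
(* [K.+1] absorbs the factor [X], [K0.+1] dominates the constant term, and the sum dominates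
   both. *)
exists (K.+1 + K0.+1)%N, (C * K%:R + (`|d| + 1)); split => // [|n].
  by rewrite addr_gt0 // ?mulr_gt0 ?ltr0n // ltr_wpDl.
rewrite hornerD hornerMX hornerC mulrDl; apply: (le_trans (ler_normD _ _)).
rewrite mulrDl; apply: lerD.
  rewrite mulrAC normrM (ger0_norm (ler0n _ _)).
  apply: (@le_trans _ _ (C * pochhammer K%:R n * n%:R)); first by rewrite ler_wpM2r.
  rewrite -!mulrA ler_wpM2l ?(ltW C0) //.
  apply: (@le_trans _ _ (K%:R * pochhammer K.+1%:R n)).
    rewrite -natr1 -pochhammerSl pochhammerS mulrDr lerDr mulr_ge0 //.
    exact: pochhammer_ge0.
  by rewrite ler_wpM2l.
rewrite normrM; apply: ler_pM => //; first by rewrite lerDl.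
by apply: (le_trans (base n)); rewrite addnC.
Qed.

(** For [K = 1] the weight is [a^n]; raising [K] by one multiplies it by the linear polynomial
    [n / K + 1]. *)
Lemma meixnerw_nat_decay K : (0 < K)%N -> expdecay (meixnerw a K%:R).
Proof.
elim: K => // -[|K] IHK _.
  exists 1, a; split => // [|n]; first exact: ltW.
  rewrite /meixnerw; have -> : pochhammer 1%:R n = n`!%:R :> R.
    elim: n => [|n IHn]; first by rewrite pochhammer0.
    by rewrite pochhammerS IHn factS natrM nat1r mulrC.
  rewrite mulfK ?fact_neq0 // mul1r ger0_norm // exprn_ge0 //; exact: ltW.
pose p : {poly R} := K.+1%:R^-1 *: 'X + 1.
rewrite (_ : meixnerw a K.+2%:R = fun n => p.[n%:R] * meixnerw a K.+1%:R n).
  by apply: expdecay_poly; exact: IHK.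
apply/funext => n; rewrite /meixnerw hornerD hornerZ hornerX hornerC.
have K0 : K.+1%:R != 0 :> R by rewrite pnatr_eq0.
have E : K.+1%:R * pochhammer K.+2%:R n = pochhammer K.+1%:R n * (K.+1%:R + n%:R) :> R.
  have -> : K.+2%:R = K.+1%:R + 1 :> R by rewrite natr1.
  by rewrite -pochhammerSl pochhammerS.
apply: (mulfI K0).
transitivity (a ^+ n / n`!%:R * (K.+1%:R * pochhammer K.+2%:R n)); first by ring.
by rewrite E; field; rewrite fact_neq0 nat1r.
Qed.

Lemma poly_meixnerw_le (p : {poly R}) c : exists K C, [/\ (0 < K)%N, 0 < C &
  forall n, `|p.[n%:R] * meixnerw a c n| <= C * meixnerw a K%:R n].
Proof.
have [K [C [K0 C0 pK]]] := poly_pochhammer_le p c; exists K, C; split=> // n.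
have w0 : 0 <= a ^+ n / n`!%:R by rewrite divr_ge0 // exprn_ge0 // ltW.
rewrite (_ : _ * meixnerw a c n = a ^+ n / n`!%:R * (p.[n%:R] * pochhammer c n)).
  rewrite normrM (ger0_norm w0) /meixnerw.
  rewrite (_ : C * _ = a ^+ n / n`!%:R * (C * pochhammer K%:R n)); last by ring.
  by rewrite ler_wpM2l.
by rewrite /meixnerw; ring.
Qed.

Lemma meixnerw_decay c : expdecay (meixnerw a c).
Proof.
have [K [C [K0 C0 cK]]] := poly_meixnerw_le 1 c.
apply: (expdecay_le (ltW C0) (meixnerw_nat_decay K0)) => n.
move: (cK n); rewrite hornerC mul1r => /le_trans; apply.
by rewrite ler_wpM2l ?(ltW C0) // ler_norm.
Qed.

(** Sum the recurrence [w_(c+1)(n + 1) = a w_(c+1)(n) + w_c(n + 1)]. The total mass is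
    [(1 - a)^(-c)], but only its ratios and its sign are needed. *)
Lemma nsum_meixnerwS c : nsum (meixnerw a (c + 1)) = nsum (meixnerw a c) / (1 - a).
Proof.
have cv d : cvgn (series (meixnerw a d)) by exact/expdecay_cvg/meixnerw_decay.
have cvS d : cvgn (series (fun n => meixnerw a d n.+1)).
  have [C [r [C0 r0 r1 ur]]] := meixnerw_decay d.
  apply: expdecay_cvg; exists (C * r), r; split => // [|n]; first exact: mulr_ge0.
  by rewrite -mulrA -exprS.
have w0 d : meixnerw a d 0 = 1.
  by rewrite /meixnerw expr0 pochhammer0 fact0 divr1 mulr1.
have E : nsum (meixnerw a (c + 1)) =
    1 + (a * nsum (meixnerw a (c + 1)) + (nsum (meixnerw a c) - 1)).
  rewrite [LHS]nsumS // w0 [nsum (meixnerw a c)]nsumS // w0 [1 + nsum _ - 1]addrC addKr.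
  rewrite -nsumZ // -nsumD //; last exact: is_cvg_seriesZ.
  congr (_ + nsum _); apply/funext => n; rewrite /meixnerw.
  rewrite [pochhammer c _]pochhammerSl pochhammerS exprS factS natrM.
  field; by rewrite fact_neq0 nat1r pnatr_eq0.
have a1 : 1 - a != 0 by rewrite subr_eq0 gt_eqF.
by apply: (mulIf a1); rewrite divfK //; lra.
Qed.

Lemma nsum_meixnerwD c l :
  nsum (meixnerw a (c + l%:R)) = nsum (meixnerw a c) / (1 - a) ^+ l.
Proof.
elim: l => [|l IHl]; first by rewrite addr0 expr0 divr1.
by rewrite -natr1 addrA nsum_meixnerwS IHl exprSr invfM mulrA.
Qed.

(** The terms may have mixed signs when [c < 0]; raising [c] by an integer until it is positive
    changes the sum only by a positive factor. *)
Lemma nsum_meixnerw_gt0 c : 0 < nsum (meixnerw a c).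
Proof.
have a1 : 0 < 1 - a by rewrite subr_gt0.
pose l := (Num.truncn `|c|).+1.
have cl : 0 < c + l%:R.
  by rewrite -ltrBlDl sub0r; apply: le_lt_trans (ler_norm _) _; rewrite normrN truncnS_gt.
suff : 0 < nsum (meixnerw a (c + l%:R)).
  by rewrite nsum_meixnerwD pmulr_lgt0 // invr_gt0 exprn_gt0.
have w0 n : 0 < meixnerw a (c + l%:R) n.
  by rewrite /meixnerw divr_gt0 ?ltr0n ?fact_gt0 // mulr_gt0 ?exprn_gt0 ?pochhammer_gt0.
apply: lt_le_trans (w0 0%N) _; apply: nsum_ge_term => [|n]; last exact: ltW.
exact/expdecay_cvg/meixnerw_decay.
Qed.

End MeixnerWeight.

Definition risingpoly {R : realType} (c : R) (j : nat) : {poly R} :=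
  \prod_(i < j) ('X - (- (c + i%:R))%:P).

Section MeixnerOrthogonality.
Context {R : realType} (a c : R).
Hypotheses (a_gt0 : 0 < a) (a_lt1 : a < 1) (c_np : forall m, c != - m%:R).
Let a_neq0 : a != 0. Proof. by rewrite gt_eqF. Qed.
Let a_neq1 : a != 1. Proof. by rewrite lt_eqF. Qed.
Let Ba1 : 1 - a != 0. Proof. by rewrite subr_eq0 eq_sym. Qed.

Local Notation L := (momentfun (meixnerw a c)).
Local Notation S := (nsum (meixnerw a c)).
Local Notation K := (dualmeixner a c).

Lemma size_risingpoly j : size (risingpoly c j) = j.+1.
Proof. by rewrite size_prod_XsubC /index_enum -enumT size_enum_ord. Qed.

Lemma coef_risingpoly j : (risingpoly c j)`_j = 1.
Proof.
have := monic_prod_XsubC (index_enum 'I_j) predT (fun i : 'I_j => - (c + i%:R)).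
by rewrite monicE lead_coefE size_risingpoly => /eqP.
Qed.

Lemma horner_risingpoly j y : (risingpoly c j).[y] = pochhammer (c + y) j.
Proof.
by rewrite horner_prod; apply: eq_bigr => i _; rewrite !hornerE; ring.
Qed.

(** The rising factor lengthens the Pochhammer symbol by [j], and the falling factor shifts the
    summation by [l]; what remains is the total mass of the Meixner weight of parameter
    [c + l + j]. *)
Lemma momentfun_rising_falling j l :
  L (risingpoly c j * \prod_(i < l) ('X - i%:R%:P)) =
  a ^+ l * pochhammer c (l + j) * S / (1 - a) ^+ (l + j).
Proof.
rewrite /momentfun (_ : (fun n => _) = fun n =>
    a ^+ n * pochhammer c (n + j) / n`!%:R * falling n%:R l); last first.
  apply/funext => n; rewrite hornerM horner_risingpoly pochhammerD horner_prod.
  rewrite (_ : \prod_(i < l) _ = falling n%:R l) /meixnerw; first by ring.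
  by apply: eq_bigr => i _; rewrite !hornerE.
rewrite (@nsum_shift _ _ l); last 2 first.
- rewrite (_ : (fun n => _) = fun n => (risingpoly c j *
    \prod_(i < l) ('X - i%:R%:P)).[n%:R] * meixnerw a c n).
    exact/expdecay_poly/meixnerw_decay.
  apply/funext => n; rewrite hornerM horner_risingpoly pochhammerD horner_prod.
  rewrite (_ : \prod_(i < l) _ = falling n%:R l) /meixnerw; first by ring.
  by apply: eq_bigr => i _; rewrite !hornerE.
- by move=> n nl; rewrite falling_nat ffact_small // mulr0.
transitivity (nsum (fun n =>
    a ^+ l * pochhammer c (l + j) * meixnerw a (c + (l + j)%:R) n)).
  congr nsum; apply/funext => n; rewrite falling_nat.
  have := ffact_fact (leq_addl n l); rewrite addnK.
  move/(congr1 (fun m => m%:R : R)); rewrite natrM => <-.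
  have f0 : (n`!%:R : R) != 0 := fact_neq0 n.
  have g0 : ((n + l) ^_ l)%:R != 0 :> R by rewrite pnatr_eq0 -lt0n ffact_gt0 leq_addl.
  rewrite /meixnerw -[(n + l + j)%N]addnA [(n + (l + j))%N]addnC.
  rewrite [pochhammer c (l + j + n)]pochhammerD [a ^+ (n + l)]exprD.
  by field; rewrite f0 g0.
rewrite nsumZ; last exact/expdecay_cvg/meixnerw_decay.
by rewrite nsum_meixnerwD // !mulrA.
Qed.

(** By [(c)_(l+j) = (c)_l (c + l)_j], the sum over [l] becomes, up to sign, an [i]-th finite
    difference of a polynomial of degree [j]. *)
Lemma momentfun_dual_rising i j : (j <= i)%N -> L (K i * risingpoly c j) =
  if j == i then S * (-1) ^+ i * i`!%:R / (1 - a) ^+ i else 0.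
Proof.
move=> ji; rewrite /dualmeixner mulr_suml (momentfun_sum (meixnerw_decay a_gt0 a_lt1 c)) //.
transitivity (S / (1 - a) ^+ j *
   \sum_(l < i.+1) 'C(i, l)%:R * ((-1) ^+ l * pochhammer (c + l%:R) j)).
  rewrite mulr_sumr; apply: eq_bigr => l _.
  rewrite -scalerAl (momentfunZ (meixnerw_decay a_gt0 a_lt1 c)) // mulrC.
  rewrite [X in L X]mulrC momentfun_rising_falling pochhammerD.
  have -> : (1 - a^-1) ^+ l = (-1) ^+ l * (1 - a) ^+ l / a ^+ l.
    rewrite -exprMn -expr_div_n; congr (_ ^+ _); field; exact: a_neq0.
  rewrite exprD; have p0 := @pochhammer_neq0 _ _ l c_np.
  have al : a ^+ l != 0 by rewrite expf_neq0.
  have a1l : (1 - a) ^+ l != 0 by rewrite expf_neq0.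
  have a1j : (1 - a) ^+ j != 0 by rewrite expf_neq0.
  by field; rewrite p0 al a1l a1j.
rewrite alternating_sum_pochhammer //; case: eqP => [->|_]; last by rewrite mulr0.
by ring.
Qed.

Lemma momentfun_dualmeixner i (q : {poly R}) : (size q <= i.+1)%N ->
  L (K i * q) = q`_i * (S * (-1) ^+ i * i`!%:R / (1 - a) ^+ i).
Proof.
move=> szq; have [b ->] := graded_basis_span size_risingpoly szq.
rewrite mulr_sumr (momentfun_sum (meixnerw_decay a_gt0 a_lt1 c)) //.
under eq_bigr => j _ do rewrite -scalerAr (momentfunZ (meixnerw_decay a_gt0 a_lt1 c))
  momentfun_dual_rising -1?ltnS //.
rewrite big_ord_recr /= eqxx big1 ?add0r => [|j _]; last first.
  by rewrite ltn_eqF // mulr0.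
congr (_ * _); rewrite big_ord_recr /= coefD coefZ coef_risingpoly mulr1 coef_sum.
rewrite big1 ?add0r // => j _; rewrite coefZ nth_default ?mulr0 //.
by rewrite size_risingpoly.
Qed.

Lemma momentfun_dualmeixner_lt i (q : {poly R}) : (size q <= i)%N -> L (K i * q) = 0.
Proof.
by move=> szq; rewrite momentfun_dualmeixner ?nth_default ?mul0r // ltnW.
Qed.

(** The norm is the reciprocal of the weight up to the constant [S]; together with
    [dualmeixner_sym], this is the self-duality behind [meixner_dense]. *)
Lemma momentfun_dualmeixner_sqr i :
  L (K i * K i) = S / meixnerw a c i.
Proof.
rewrite momentfun_dualmeixner ?size_dualmeixner //.
rewrite coef_dualmeixner // /meixnerw.
have -> : (1 - a^-1) ^+ i = (-1) ^+ i * (1 - a) ^+ i / a ^+ i.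
  rewrite -exprMn -expr_div_n; congr (_ ^+ _); field; exact: a_neq0.
have sgn : (-1) ^+ i * (-1) ^+ i = 1 :> R by rewrite -exprMn mulrNN mulr1 expr1n.
have p0 := @pochhammer_neq0 _ _ i c_np.
have al : a ^+ i != 0 by rewrite expf_neq0.
have a1l : (1 - a) ^+ i != 0 by rewrite expf_neq0.
rewrite -[RHS]mul1r -[X in X * (S / _)]sgn; field.
by rewrite p0 al a1l fact_neq0.
Qed.

End MeixnerOrthogonality.

(** * Density of polynomials and dual orthogonality *)

Lemma cvg_series_delta {R : realType} (n : nat) (k : R) :
  series (fun m => k *+ (m == n)) @ \oo --> k.
Proof.
rewrite -(cvg_shiftn n.+1) /=; apply: cvg_near_cst; near=> m.
rewrite /series /= (bigD1_seq n) ?mem_index_iota ?iota_uniq //=; last first.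
  by rewrite addnS ltnS leq_addl.
by rewrite eqxx big1 ?addr0 // => i /negPf ->.
Unshelve. all: by end_near. Qed.

(* The squared [u]-norm of the difference of [q] and the indicator of [n]. *)
Definition indicator_err {R : realType} (u : nat -> R) (n : nat) (q : {poly R}) :=
  u n - 2 * u n * q.[n%:R] + momentfun u (q * q).

Section IndicatorError.
Context {R : realType}.
Implicit Types (u v : nat -> R) (q : {poly R}).

Lemma cvg_indicator_err u n q : expdecay u ->
  series (fun m => u m * ((m == n)%:R - q.[m%:R]) ^+ 2) @ \oo -->
    indicator_err u n q.
Proof.
move=> du; rewrite (_ : (fun m => _) =
   (fun m => (u n - 2 * u n * q.[n%:R]) *+ (m == n)) +
   (fun m => (q * q).[m%:R] * u m)).
  rewrite seriesD; apply: cvgD; first exact: cvg_series_delta.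
  exact: (momentfun_cvg du).
apply/funext => m; transitivity
  ((u n - 2 * u n * q.[n%:R]) *+ (m == n) + (q * q).[m%:R] * u m) => //.
by rewrite hornerM; case: eqP => [->|_]; rewrite /= 2?mulr1n 2?mulr0n; ring.
Qed.

Lemma indicator_err_ge u n q m : expdecay u -> (forall m, 0 <= u m) ->
  u m * ((m == n)%:R - q.[m%:R]) ^+ 2 <= indicator_err u n q.
Proof.
move=> du u0; have := @cvg_indicator_err u n q du => cE.
rewrite -(cvg_lim _ cE) //; apply: (@nsum_ge_term _ _ m).
  by apply/cvg_ex; eexists; exact: cE.
by move=> i; rewrite mulr_ge0 ?sqr_ge0.
Qed.

Lemma indicator_err_le u v C n q : expdecay u -> expdecay v ->
  (forall m, v m <= C * u m) -> indicator_err v n q <= C * indicator_err u n q.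
Proof.
move=> du dv vu.
have cu : C *: series (fun m => u m * ((m == n)%:R - q.[m%:R]) ^+ 2) @ \oo -->
    C * indicator_err u n q.
  by apply: cvgZl_tmp; exact: cvg_indicator_err.
apply: (ler_cvg_to (@cvg_indicator_err v n q dv) cu); near=> N.
rewrite -seriesZ; apply: ler_sum => i _.
rewrite [leRHS](_ : _ = C * u i * ((i == n)%:R - q.[i%:R]) ^+ 2).
  by rewrite ler_wpM2r ?sqr_ge0.
by rewrite -mulrA.
Unshelve. all: by end_near. Qed.

End IndicatorError.

Section DualOrthogonality.
Context {R : realType} (u : nat -> R) (B : nat -> {poly R}) (N : nat -> R).
Hypotheses (u_decay : expdecay u) (u_ge0 : forall m, 0 <= u m).
Hypotheses (sizeB : forall j, size (B j) = j.+1) (N_gt0 : forall j, 0 < N j).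
Hypothesis orthoB : forall i j, momentfun u (B i * B j) = if i == j then N i else 0.

(** The orthogonal projection of the indicator of [n], whose inner product with [B j] is [u n * (B
    j).[n]]. *)
Definition indicator_proj (n M : nat) : {poly R} :=
  \sum_(j < M) (u n * (B j).[n%:R] / N j) *: B j.

Lemma indicator_err_sum n M (b : nat -> R) :
  indicator_err u n (\sum_(j < M) b j *: B j) =
  u n + \sum_(j < M) (N j * b j ^+ 2 - 2 * (b j * (u n * (B j).[n%:R]))).
Proof.
rewrite /indicator_err horner_sum mulr_suml (momentfun_sum u_decay).
rewrite -addrA; congr (_ + _); rewrite mulr_sumr -sumrN -big_split /=.
have LZ (x y : R) (p q : {poly R}) :
    momentfun u ((x *: p) * (y *: q)) = x * y * momentfun u (p * q).
  by rewrite -scalerAl -scalerAr scalerA (momentfunZ u_decay).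
apply: eq_bigr => j _; rewrite hornerZ mulr_sumr (momentfun_sum u_decay).
rewrite (bigD1 j) //= big1 ?addr0 => [|i ij]; rewrite LZ orthoB.
  by rewrite eqxx; ring.
by rewrite eq_sym (negPf ij : (nat_of_ord i == j) = false) mulr0.
Qed.

Lemma indicator_err_proj n M : indicator_err u n (indicator_proj n M) =
  u n - \sum_(j < M) (u n * (B j).[n%:R]) ^+ 2 / N j.
Proof.
rewrite (indicator_err_sum n M (fun j => u n * (B j).[n%:R] / N j)).
congr (_ + _); rewrite -sumrN; apply: eq_bigr => j _.
by have N0 := lt0r_neq0 (N_gt0 j); field.
Qed.

Lemma indicator_proj_best n M (q : {poly R}) : (size q <= M)%N ->
  indicator_err u n (indicator_proj n M) <= indicator_err u n q.
Proof.
move=> szq; have [b ->] := graded_basis_span sizeB szq.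
rewrite indicator_err_proj indicator_err_sum -sumrN lerD2l.
apply: ler_sum => j _; rewrite -subr_ge0.
set s := u n * _; have N0 := lt0r_neq0 (N_gt0 j).
rewrite [leRHS](_ : _ = N j * (b j - s / N j) ^+ 2); last by field.
by rewrite mulr_ge0 ?sqr_ge0 // ltW.
Qed.

(** The partial sums are the values at [m] of the projections of the indicator of [n]. These tend to
    the indicator in mean square, hence pointwise wherever the weight is positive. *)
Lemma cvg_dual_orthogonality n m :
  (forall e : R, 0 < e -> exists q, indicator_err u n q < e) -> 0 < u m ->
  series (fun j => u n * (B j).[n%:R] * (B j).[m%:R] / N j) @ \oo -->
    ((m == n)%:R : R).
Proof.
move=> dense um; apply/cvgrPdist_lt => e e0.
(* The error at the single point [m] enters the squared norm with weight [u m]. *)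
have [|q qe] := dense (u m * e ^+ 2); first by rewrite mulr_gt0 // exprn_gt0.
near=> M; have szq : (size q <= M)%N by near: M; exact: nbhs_infty_ge.
have -> : series (fun j => u n * (B j).[n%:R] * (B j).[m%:R] / N j) M =
    (indicator_proj n M).[m%:R].
  rewrite seriesEord horner_sum /=; apply: eq_bigr => j _; rewrite hornerZ; ring.
have lt : u m * ((m == n)%:R - (indicator_proj n M).[m%:R]) ^+ 2 < u m * e ^+ 2.
  apply: le_lt_trans (indicator_err_ge n _ m u_decay u_ge0) _.
  exact: le_lt_trans (indicator_proj_best n szq) qe.
move: lt; rewrite ltr_pM2l // -[X in X < _]real_normK ?num_real.
by rewrite ltr_pXn2r ?nnegrE // ltW.
Unshelve. all: by end_near. Qed.

End DualOrthogonality.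

(* Meixner polynomials are self-dual, so that Parseval's identity for the
   indicator of [n] is the norm formula of the [n]-th polynomial. *)
Lemma meixner_dense {R : realType} (a c : R) (n : nat) (e : R) :
  0 < a -> a < 1 -> 0 < c -> 0 < e ->
  exists q, indicator_err (meixnerw a c) n q < e.
Proof.
move=> a0 a1 c0 e0; have c_np m : c != - m%:R.
  by rewrite gt_eqF // (le_lt_trans _ c0) // oppr_le0.
set w := meixnerw a c; set S := nsum w.
have w0 j : 0 < w j.
  by rewrite /w /meixnerw divr_gt0 ?ltr0n ?fact_gt0 // mulr_gt0 ?exprn_gt0 ?pochhammer_gt0.
have S0 : 0 < S by exact: nsum_meixnerw_gt0.
have dw : expdecay w by exact: meixnerw_decay.
have a_neq0 : a != 0 by rewrite gt_eqF.
have a_neq1 : a != 1 by rewrite lt_eqF.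
have szK := size_dualmeixner a_neq1 c_np.
have ortho i j : momentfun w (dualmeixner a c i * dualmeixner a c j) =
    if i == j then S / w i else 0.
  wlog ji : i j / (j <= i)%N => [H|].
    have [/H //|/ltnW ij] := leqP j i.
    by rewrite mulrC H // eq_sym; case: eqP => [->|].
  case: eqP => [<-|/eqP ij]; first exact: momentfun_dualmeixner_sqr.
  by rewrite momentfun_dualmeixner_lt // szK ltn_neqAle eq_sym ij.
have N0 j : 0 < S / w j by exact: divr_gt0.
have : (fun M => indicator_err w n
    (indicator_proj w (dualmeixner a c) (fun j => S / w j) n M)) @ \oo --> (0 : R).
  under eq_fun do rewrite (indicator_err_proj dw N0 ortho).
  suff wP : (fun M => \sum_(j < M) (w n * (dualmeixner a c j).[n%:R]) ^+ 2 / (S / w j))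
      @ \oo --> w n.
    have wc : (fun _ : nat => w n) @ \oo --> w n by exact: cvg_cst.
    have := cvgB wc wP; rewrite subrr; exact.
  (* The factor [S / w n] is the squared norm of [K_n]; after swapping degree and argument by
     symmetry, the Parseval sum is its series. *)
  have -> : nbhs (w n) = nbhs (w n ^+ 2 / S * (S / w n)).
    by congr nbhs; field; rewrite !lt0r_neq0.
  rewrite (_ : (fun M => _) = (w n ^+ 2 / S) *: series (fun j =>
    (dualmeixner a c n * dualmeixner a c n).[j%:R] * w j)); last first.
    apply/funext => M; transitivity (w n ^+ 2 / S * \sum_(j < M)
      (dualmeixner a c n * dualmeixner a c n).[j%:R] * w j); last first.
      by rewrite seriesEord.
    rewrite mulr_sumr; apply: eq_bigr => j _.
    rewrite hornerM (dualmeixner_sym _ c n).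
    by field; rewrite !lt0r_neq0.
  apply: cvgZl_tmp; move: (ortho n n); rewrite eqxx => <-.
  exact: (momentfun_cvg dw).
move=> /cvgrPdist_lt /(_ e e0) [M _ /(_ M (leqnn M))] /=.
rewrite sub0r normrN => H; eexists; exact: le_lt_trans (ler_norm _) H.
Qed.

Section FiniteSupportSeries.
Context {R : realType}.
Implicit Types (u : nat -> R) (Y : nat).

Lemma cvg_series_trunc u Y :
  series (fun x => if (x < Y)%N then u x else 0) @ \oo --> \sum_(x < Y) u x.
Proof.
apply: cvg_near_cst; near=> m; have Ym : (Y <= m)%N by near: m; exact: nbhs_infty_ge.
by rewrite seriesEord /= (big_ord_widen m u Ym) [RHS]big_mkcond.
Unshelve. all: by end_near. Qed.

Lemma cvg_series_sum M (P : pred nat) (U : nat -> nat -> R) (l : nat -> R) :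
  (forall n, P n -> series (U n) @ \oo --> l n) ->
  series (fun x => \sum_(n < M | P n) U n x) @ \oo --> \sum_(n < M | P n) l n.
Proof.
move=> Ul; elim: M => [|M IHM].
  rewrite big_ord0 (_ : series _ = fun=> 0); first exact: cvg_cst.
  apply/funext => m; rewrite seriesEord /=; apply: big1 => x _.
  by rewrite big_ord0.
rewrite big_mkcond big_ord_recr -big_mkcond /=.
rewrite (_ : (fun x => _) = (fun x => \sum_(n < M | P n) U n x) +
    (fun x => if P M then U M x else 0)); last first.
  apply/funext => x; transitivity
    (\sum_(n < M | P n) U n x + (if P M then U M x else 0)) => //.
  by rewrite big_mkcond big_ord_recr -big_mkcond.
rewrite seriesD; apply: cvgD => //; case: ifP => PM; first exact: Ul.
rewrite (_ : series _ = fun=> 0); first exact: cvg_cst.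
by apply/funext => m; rewrite seriesEord /=; apply: big1.
Qed.

Lemma cvg_seriesZ u (k l : R) : series u @ \oo --> l ->
  series (fun x => k * u x) @ \oo --> k * l.
Proof.
move=> ul; rewrite (_ : series _ = k *: series u); first exact: cvgZl_tmp.
by rewrite -seriesZ.
Qed.

End FiniteSupportSeries.

(* A matrix with orthogonal rows and orthogonal columns: the rows [G n], [n] in
   [J], then span a dense subspace, by Parseval's identity for finitely
   supported functions. *)
Section DualDensity.
Context {R : realType} (w : nat -> R) (J : pred nat) (G : nat -> nat -> R).
Variable nu : nat -> R.
Hypotheses (w_gt0 : forall x, 0 < w x) (nu_gt0 : forall n, J n -> 0 < nu n).
Hypothesis rowsG : forall n m, J n -> J m ->
  series (fun x => w x * (G n x * G m x)) @ \oo --> if n == m then nu n else 0.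
Hypothesis colsG : forall y z,
  series (fun n => if J n then G n y * G n z / nu n else 0) @ \oo -->
    if y == z then (w y)^-1 else 0.
Variable f : nat -> R.

(** [c] collects the inner products of the truncation [phi] of [f] with the rows, [h] is the
    projection of [phi] on the first admissible rows, and [normphi] is the squared norm of [phi]. *)
Let c Y n := \sum_(y < Y) w y * f y * G n y.
Let h Y M x := \sum_(n < M | J n) c Y n / nu n * G n x.
Let phi Y x := if (x < Y)%N then f x else 0.
Let normphi Y := \sum_(y < Y) w y * f y ^+ 2.

(** Because [f] is truncated at [Y], the square of [c] is a finite double sum over points, and
    column orthogonality applies term by term. *)
Let cvg_bessel Y :
  (fun M => \sum_(n < M | J n) c Y n ^+ 2 / nu n) @ \oo --> normphi Y.
Proof.
pose U y z n := if J n then G n y * G n z / nu n else 0.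
pose b y := w y * f y.
have -> : normphi Y = \sum_(y < Y | xpredT (val y)) \sum_(z < Y | xpredT (val z))
    b y * b z * (if val y == val z then (w y)^-1 else 0).
  apply: eq_bigr => y _; rewrite (bigD1 y) //= eqxx big1 ?addr0 => [|z zy].
    by rewrite /b; field; rewrite gt_eqF.
  by rewrite eq_sym (negPf zy : (val z == val y) = false) mulr0.
have -> : (fun M => \sum_(n < M | J n) c Y n ^+ 2 / nu n) =
    series (fun n => \sum_(y < Y | xpredT (val y)) \sum_(z < Y | xpredT (val z))
      b y * b z * U y z n).
  apply/funext => M; rewrite seriesEord /= big_mkcond; apply: eq_bigr => n _.
  rewrite /U; case: ifP => Jn; last first.
    by rewrite big1 // => y _; rewrite big1 // => z _; rewrite mulr0.
  rewrite expr2 /c mulr_suml mulr_suml; apply: eq_bigr => y _.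
  rewrite mulr_sumr mulr_suml; apply: eq_bigr => z _; rewrite /b; ring.
apply: (@cvg_series_sum _ Y xpredT (fun y n => \sum_(z < Y | xpredT (val z))
  b y * b z * U y z n) (fun y => \sum_(z < Y | xpredT (val z))
    b y * b z * (if y == val z then (w y)^-1 else 0))) => y _.
apply: (@cvg_series_sum _ Y xpredT (fun z n => b y * b z * U y z n)
  (fun z => b y * b z * (if y == z then (w y)^-1 else 0))) => z _.
exact: cvg_seriesZ (@colsG y z).
Qed.

(** Bessel's identity: the square is expanded and only row orthogonality is used. *)
Let cvg_err Y M : series (fun x => w x * (phi Y x - h Y M x) ^+ 2) @ \oo -->
  normphi Y - \sum_(n < M | J n) c Y n ^+ 2 / nu n.
Proof.
pose A x := if (x < Y)%N then w x * f x ^+ 2 else 0.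
pose B n x := if (x < Y)%N then w x * f x * G n x else 0.
pose b n := c Y n / nu n.
have cA : series A @ \oo --> normphi Y by exact: cvg_series_trunc.
have cB : series (fun x => \sum_(n < M | J n) b n * B n x) @ \oo -->
    \sum_(n < M | J n) b n * c Y n.
  apply: (@cvg_series_sum _ M J (fun n x => b n * B n x) (fun n => b n * c Y n)) => n _.
  exact: cvg_seriesZ (@cvg_series_trunc _ (fun x => w x * f x * G n x) Y).
have cC : series (fun x => \sum_(n < M | J n) \sum_(m < M | J m)
      b n * b m * (w x * (G n x * G m x))) @ \oo -->
    \sum_(n < M | J n) \sum_(m < M | J m) b n * b m *
      (if val n == val m then nu n else 0).
  apply: (@cvg_series_sum _ M J (fun n x => \sum_(m < M | J m)
      b n * b m * (w x * (G n x * G m x))) (fun n => \sum_(m < M | J m) b n * b m *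
      (if n == val m then nu n else 0))) => n Jn.
  apply: (@cvg_series_sum _ M J (fun m x => b n * b m * (w x * (G n x * G m x)))
    (fun m => b n * b m * (if n == m then nu n else 0))) => m Jm.
  exact: cvg_seriesZ (rowsG Jn Jm).
have E : normphi Y - \sum_(n < M | J n) c Y n ^+ 2 / nu n =
   normphi Y - 2 * (\sum_(n < M | J n) b n * c Y n) +
   \sum_(n < M | J n) \sum_(m < M | J m) b n * b m *
      (if val n == val m then nu n else 0).
  rewrite -addrA; congr (_ + _); rewrite mulr_sumr -!sumrN -big_split /=.
  apply: eq_bigr => n Jn; rewrite (bigD1 n) //= eqxx big1 ?addr0 => [|m /andP[_ mn]].
    by rewrite /b; field; rewrite gt_eqF ?nu_gt0.
  by rewrite eq_sym (negPf mn : (val m == val n) = false) mulr0.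
rewrite E (_ : (fun x => w x * (phi Y x - h Y M x) ^+ 2) =
   (A - 2 *: (fun x => \sum_(n < M | J n) b n * B n x)) +
   (fun x => \sum_(n < M | J n) \sum_(m < M | J m)
      b n * b m * (w x * (G n x * G m x)))).
  rewrite seriesD seriesD seriesN seriesZ.
  by apply: cvgD => //; apply: cvgB => //; exact: cvgZl_tmp.
apply/funext => x; transitivity (A x - 2 * (\sum_(n < M | J n) b n * B n x) +
   \sum_(n < M | J n) \sum_(m < M | J m) b n * b m * (w x * (G n x * G m x))) => //.
have -> : \sum_(n < M | J n) \sum_(m < M | J m) b n * b m * (w x * (G n x * G m x)) =
    w x * h Y M x ^+ 2.
  rewrite expr2 {1}/h mulr_suml mulr_sumr; apply: eq_bigr => n _.
  rewrite /h !mulr_sumr; apply: eq_bigr => m _; rewrite /b; ring.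
have -> : \sum_(n < M | J n) b n * B n x = w x * phi Y x * h Y M x.
  rewrite /h mulr_sumr; apply: eq_bigr => n _; rewrite /B /phi /b.
  by case: ifP => _; ring.
by rewrite /A /phi; case: ifP => _; ring.
Qed.

Lemma dual_density (e : R) : cvgn (series (fun x => w x * f x ^+ 2)) -> 0 < e ->
  exists M (b : nat -> R) (s : R), s < e /\
    series (fun x => w x * (f x - \sum_(n < M | J n) b n * G n x) ^+ 2) @ \oo --> s.
Proof.
move=> /cvg_ex[T fT] e0.
(* Truncation and projection each cost less than [e / 4], and [(x + y)^2 <= 2 x^2 + 2 y^2] doubles
   both. *)
have e4 : 0 < e / 4 by lra.
have [Y YT] : exists Y, T - normphi Y < e / 4.
  move/cvgrPdist_lt : (fT) => /(_ _ e4)[Y _ /(_ Y (leqnn Y))] /=.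
  by rewrite seriesEord => /(le_lt_trans (ler_norm _)) ?; exists Y.
have [M MY] : exists M, normphi Y - \sum_(n < M | J n) c Y n ^+ 2 / nu n < e / 4.
  move/cvgrPdist_lt : (@cvg_bessel Y) => /(_ _ e4)[M _ /(_ M (leqnn M))] /=.
  by move=> /(le_lt_trans (ler_norm _)) ?; exists M.
exists M, (fun n => c Y n / nu n).
have ctail : series (fun x => w x * (f x - phi Y x) ^+ 2) @ \oo --> T - normphi Y.
  rewrite (_ : (fun x => _) = (fun x => w x * f x ^+ 2) -
      (fun x => if (x < Y)%N then w x * f x ^+ 2 else 0)).
    by rewrite seriesD seriesN; apply: cvgB => //; exact: cvg_series_trunc.
  apply/funext => x; transitivity (w x * f x ^+ 2 -
    (if (x < Y)%N then w x * f x ^+ 2 else 0)) => //.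
  by rewrite /phi; case: ifP => _; ring.
pose bound := 2 *: (fun x => w x * (f x - phi Y x) ^+ 2) +
  2 *: (fun x => w x * (phi Y x - h Y M x) ^+ 2).
have cbound : series bound @ \oo --> 2 * (T - normphi Y) +
    2 * (normphi Y - \sum_(n < M | J n) c Y n ^+ 2 / nu n).
  rewrite seriesD !seriesZ; apply: cvgD; apply: cvgZl_tmp => //; exact: cvg_err.
have le_bound x : w x * (f x - h Y M x) ^+ 2 <= bound x.
  rewrite [leRHS](_ : _ = 2 * (w x * (f x - phi Y x) ^+ 2) +
    2 * (w x * (phi Y x - h Y M x) ^+ 2)) // -subr_ge0.
  rewrite [leRHS](_ : _ = w x * (f x - phi Y x - (phi Y x - h Y M x)) ^+ 2); last by ring.
  by rewrite mulr_ge0 ?sqr_ge0 // ltW.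
have err_ge0 x : 0 <= w x * (f x - h Y M x) ^+ 2 by rewrite mulr_ge0 ?sqr_ge0 // ltW.
have cv : cvgn (series (fun x => w x * (f x - h Y M x) ^+ 2)).
  apply: (@series_le_cvg _ _ bound) => // [x|]; first exact: le_trans (le_bound x).
  by apply/cvg_ex; eexists; exact: cbound.
exists (nsum (fun x => w x * (f x - h Y M x) ^+ 2)); split; last exact: cv.
apply: (@le_lt_trans _ _ (2 * (T - normphi Y) +
    2 * (normphi Y - \sum_(n < M | J n) c Y n ^+ 2 / nu n))); last by lra.
rewrite -(cvg_lim _ cbound) //; apply: lim_series_le => //.
by apply/cvg_ex; eexists; exact: cbound.
Qed.

End DualDensity.

(** * Christoffel transforms *)

Section Christoffel.
Context {R : realType} (B : nat -> {poly R}) (k : nat) (t : 'I_k -> R).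
Hypotheses (sizeB : forall j, size (B j) = j.+1) (t_inj : injective t).
Implicit Types (x y : nat) (z : R).

Definition nodemx x z : 'M[R]_k.+1 :=
  \matrix_(i < k.+1, j < k.+1) (B (x + j)).[oapp t z (unlift ord0 i)].

Definition casoratian x : R :=
  \det (\matrix_(i < k, j < k) (B (x + j)).[t i]).

(** The cofactors along the top row do not involve [z]; the value [0] in [nodemx] is a
    placeholder. *)
Definition christoffel x : {poly R} :=
  \sum_(j < k.+1) cofactor (nodemx x 0) ord0 j *: B (x + j).

Definition nodepoly : {poly R} := \prod_(i < k) ('X - (t i)%:P).

Lemma horner_christoffel x z : (christoffel x).[z] = \det (nodemx x z).
Proof.
rewrite (expand_det_row _ ord0) horner_sum; apply: eq_bigr => j _.
rewrite hornerZ mulrC mxE unlift_none /=; congr (_ * (_ * \det _)).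
by apply/matrixP => i l; rewrite !mxE liftK.
Qed.

Lemma cofactor_nodemx_max x :
  cofactor (nodemx x 0) ord0 ord_max = (-1) ^+ k * casoratian x.
Proof.
rewrite /cofactor add0n; congr (_ * \det _).
by apply/matrixP => i j; rewrite !mxE liftK /= /bump leqNgt ltn_ord.
Qed.

Lemma cofactor_nodemx0 x :
  cofactor (nodemx x 0) ord0 ord0 = casoratian x.+1.
Proof.
rewrite /cofactor addn0 expr0 mul1r; congr (\det _).
by apply/matrixP => i j; rewrite !mxE liftK /= addSnnS.
Qed.

Lemma monic_nodepoly : nodepoly \is monic.
Proof. exact: monic_prod_XsubC. Qed.

Lemma size_nodepoly : size nodepoly = k.+1.
Proof. by rewrite size_prod_XsubC /index_enum -enumT size_enum_ord. Qed.

Lemma nodepoly_dvdp (p : {poly R}) : (forall i, p.[t i] = 0) -> nodepoly %| p.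
Proof.
move=> pt; rewrite /nodepoly -(big_map t predT (fun z => 'X - z%:P)).
apply: uniq_roots_dvdp; first by apply/allP => z /mapP[i _ ->]; apply/rootP.
by rewrite uniq_rootsE map_inj_uniq // index_enum_uniq.
Qed.

Lemma nodepoly_dvd_christoffel x : nodepoly %| christoffel x.
Proof.
apply: nodepoly_dvdp => i; rewrite horner_christoffel.
apply: (@determinant_alternate _ _ _ ord0 (lift ord0 i)) => //.
by move=> j; rewrite !mxE liftK unlift_none.
Qed.

(** The polynomials [R_x] of the overview. *)
Definition christoffelq x : {poly R} := christoffel x %/ nodepoly.

Lemma christoffelqK x : christoffelq x * nodepoly = christoffel x.
Proof. by rewrite divpK // nodepoly_dvd_christoffel. Qed.

Lemma graded_basis_free x M (b : 'I_M -> R) :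
  \sum_(j < M) b j *: B (x + j) = 0 -> forall j, b j = 0.
Proof.
elim: M b => [|M IHM] b b0 j; first by case: j.
have lB : (B (x + M))`_(x + M) != 0.
  have : lead_coef (B (x + M)) != 0 by rewrite lead_coef_eq0 -size_poly_gt0 sizeB.
  by rewrite lead_coefE sizeB.
move: (b0); rewrite big_ord_recr /= => /(congr1 (fun p : {poly R} => p`_(x + M))).
rewrite coefD coefZ coef0 coef_sum big1 ?add0r => [/eqP|i _]; last first.
  by rewrite coefZ nth_default ?mulr0 // sizeB ltn_add2l.
rewrite mulf_eq0 (negPf lB) orbF => /eqP bM.
move: b0; rewrite big_ord_recr /= bM scale0r addr0.
move=> /(IHM (fun i => b (widen_ord (leqnSn M) i))) bi.
have [i ->|->//] := unliftP ord_max j.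
by rewrite -(bi i); congr b; apply/val_inj; rewrite /= /bump leqNgt ltn_ord.
Qed.

Lemma size_christoffel x : casoratian x != 0 -> size (christoffel x) = (x + k).+1.
Proof.
move=> W0; have c0 : cofactor (nodemx x 0) ord0 ord_max != 0.
  by rewrite cofactor_nodemx_max mulf_neq0 // expf_neq0 // oppr_eq0 oner_eq0.
rewrite /christoffel big_ord_recr /= addrC.
have szk : size (cofactor (nodemx x 0) ord0 ord_max *: B (x + k)) = (x + k).+1.
  by rewrite size_scale // sizeB.
rewrite size_polyDl szk // ltnS.
apply: (leq_trans (size_sum _ _ _)); apply/bigmax_leqP => j _.
by apply: (leq_trans (size_scale_leq _ _)); rewrite sizeB ltn_add2l.
Qed.

Lemma size_christoffelq x : casoratian x != 0 -> size (christoffelq x) = x.+1.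
Proof.
move=> W0; rewrite size_divp ?monic_neq0 ?monic_nodepoly //.
by rewrite size_nodepoly size_christoffel //= -addSn addnK.
Qed.

Lemma coef_christoffelq x : casoratian x != 0 ->
  (christoffelq x)`_x = (-1) ^+ k * casoratian x * (B (x + k))`_(x + k).
Proof.
move=> W0; transitivity (lead_coef (christoffelq x)).
  by rewrite lead_coefE size_christoffelq.
have := lead_coefM (christoffelq x) nodepoly.
rewrite christoffelqK (monicP monic_nodepoly) mulr1 => <-.
rewrite lead_coefE size_christoffel //= /christoffel big_ord_recr /= coefD coefZ.
rewrite cofactor_nodemx_max coef_sum big1 ?add0r // => j _.
by rewrite coefZ nth_default ?mulr0 // sizeB ltn_add2l.
Qed.

Section Orthogonality.
Variables (u : nat -> R) (kappa : nat -> R).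
Hypothesis u_decay : expdecay u.
Local Notation L := (momentfun u).
Hypothesis orthoB : forall i (q : {poly R}), (size q <= i.+1)%N ->
  L (B i * q) = q`_i * kappa i.
Hypothesis nodepoly_def : forall p : {poly R}, p != 0 -> L (p * p * nodepoly) != 0.

Let orthoB_lt i (q : {poly R}) : (size q <= i)%N -> L (B i * q) = 0.
Proof.
move=> szq; rewrite orthoB ?nth_default ?mul0r //; exact: leq_trans szq _.
Qed.

(* If the determinant vanished, a combination [r * nodepoly] of the [B (x + j)],
   [j < k], with [size r <= x], would be orthogonal to [r]. *)
Lemma casoratian_neq0 x : casoratian x != 0.
Proof.
apply/negP; rewrite /casoratian -det_tr => /det0P[v v0 vA].
pose p : {poly R} := \sum_(j < k) v ord0 j *: B (x + j).
have pP : nodepoly %| p.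
  apply: nodepoly_dvdp => i; have := congr1 (fun m : 'rV_k => m ord0 i) vA.
  rewrite !mxE => vi; rewrite horner_sum -[RHS]vi; apply: eq_bigr => j _.
  by rewrite !mxE hornerZ.
have szr : (size (p %/ nodepoly)%R <= x)%N.
  rewrite size_divp ?monic_neq0 ?monic_nodepoly // size_nodepoly leq_subLR addnC.
  apply: (leq_trans (size_sum _ _ _)); apply/bigmax_leqP => j _.
  by apply: (leq_trans (size_scale_leq _ _)); rewrite sizeB ltn_add2l.
have r0 : p %/ nodepoly = 0.
  apply/eqP/negPn/negP => /nodepoly_def /negP; apply; apply/eqP.
  rewrite -mulrA divpK // mulrC /p mulr_suml (momentfun_sum u_decay) big1 // => j _.
  rewrite -scalerAl (momentfunZ u_decay) orthoB_lt ?mulr0 //.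
  exact: leq_trans szr (leq_addr _ _).
have p0 : p = 0 by rewrite -(divpK pP) r0 mul0r.
case/eqP: v0; apply/rowP => j; rewrite mxE; exact: (graded_basis_free p0).
Qed.

(** Multiplying by [nodepoly] restores the combination of the [B (x + j)]; all of these with [j > 0]
    are orthogonal to [q], and the coefficient of [B x] is the next Casorati determinant. *)
Lemma momentfun_christoffelq_mul x (q : {poly R}) : (size q <= x.+1)%N ->
  L (christoffelq x * q * nodepoly) = casoratian x.+1 * (q`_x * kappa x).
Proof.
move=> szq; rewrite mulrAC christoffelqK /christoffel mulr_suml.
rewrite (momentfun_sum u_decay) big_ord_recl /= big1 ?addr0 => [|j _].
  by rewrite -scalerAl (momentfunZ u_decay) addn0 orthoB // cofactor_nodemx0.
rewrite -scalerAl (momentfunZ u_decay) orthoB_lt ?mulr0 //.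
by apply: leq_trans szq _; rewrite /bump /= add1n addnS ltnS leq_addr.
Qed.

Lemma momentfun_christoffelq x y :
  L (christoffelq x * christoffelq y * nodepoly) =
  if x == y then (-1) ^+ k * casoratian x * casoratian x.+1 *
    (B (x + k))`_(x + k) * kappa x else 0.
Proof.
wlog yx : x y / (y <= x)%N => [H|].
  have [/H //|/ltnW xy] := leqP y x.
  by rewrite [X in X * _]mulrC H // eq_sym; case: eqP => [->|].
have W0 := casoratian_neq0.
rewrite momentfun_christoffelq_mul ?size_christoffelq //.
have [<-|xy] := eqVneq; first by rewrite coef_christoffelq //; ring.
by rewrite nth_default ?mul0r ?mulr0 // size_christoffelq // ltn_neqAle eq_sym xy.
Qed.

End Orthogonality.
End Christoffel.

(** * The Gamma function *)

Section GammaFunction.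
Context {R : realType}.
Implicit Types (z : R) (n : nat).
Local Notation mu := (@lebesgue_measure R).

Definition Gamma_integrand z (t : R) : R := t `^ (z - 1) * expR (- t).

(** Extended real values allow the functional equation to be proved before finiteness, which is then
    deduced from it. *)
Definition Gamma_eint z : \bar R :=
  (\int[mu]_(t in `]0%R, +oo[) (Gamma_integrand z t)%:E)%E.

Lemma Gamma_integrand_ge0 z t : 0 <= Gamma_integrand z t.
Proof. by rewrite mulr_ge0 ?powR_ge0 ?expR_ge0. Qed.

Lemma measurable_Gamma_integrand z (D : set R) :
  measurable D -> measurable_fun D (EFin \o Gamma_integrand z).
Proof.
move=> mD; apply/measurable_EFinP/measurable_funTS; apply: measurable_funM.
  exact: measurable_powR.
by apply: measurableT_comp => //; exact: measurable_oppr.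
Qed.

Lemma Gamma_eint_ge0 z : (0 <= Gamma_eint z)%E.
Proof. by apply: integral_ge0 => t _; rewrite lee_fin Gamma_integrand_ge0. Qed.

(** Compact intervals exhausting the half-line, on which integration by parts applies; the offset
    [2] keeps the endpoints distinct. *)
Let itv n : set R := `[n.+2%:R^-1, n.+2%:R]%classic.

Let itvP n t : itv n t -> 0 < t.
Proof.
rewrite /itv /= in_itv /= => /andP[nt _]; apply: lt_le_trans nt.
by rewrite invr_gt0.
Qed.

Let bigcup_itv : \bigcup_n itv n = `]0%R, +oo[%classic.
Proof.
apply/seteqP; split => t; first by case=> n _ /itvP; rewrite /= in_itv /= andbT.
rewrite /= in_itv /= andbT => t0.
exists (maxn (Num.truncn t) (Num.truncn t^-1)) => //; rewrite /itv /= in_itv /=.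
have le u m : (Num.truncn u <= m)%N -> u <= m.+2%:R :> R.
  move=> um; apply: ltW; apply: (lt_le_trans (truncnS_gt u)).
  by rewrite ler_nat ltnS leqW.
by rewrite (le _ _ (leq_maxl _ _)) andbT invf_ple ?posrE ?ltr0n // le ?leq_maxr.
Qed.

Let cvg_itv z : (\int[mu]_(t in itv n) (Gamma_integrand z t)%:E)%E
  @[n --> \oo] --> Gamma_eint z.
Proof.
rewrite /Gamma_eint -bigcup_itv; apply: ge0_nondecreasing_set_cvg_integral.
- apply/nondecreasing_seqP => n; rewrite subsetEset => t; rewrite /itv /= !in_itv /=.
  move=> /andP[nt tn]; apply/andP; split.
    by apply: le_trans nt; rewrite lef_pV2 ?posrE ?ler_nat.
  by apply: le_trans tn _; rewrite ler_nat.
- by move=> n; exact: measurable_itv.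
- by move=> n; apply: measurable_Gamma_integrand; exact: measurable_itv.
- by move=> n t _; rewrite lee_fin Gamma_integrand_ge0.
Qed.

Let bdry z t : R := t `^ z * expR (- t).

Let itv_by_parts z n : 0 < z ->
  (\int[mu]_(t in itv n) (Gamma_integrand (z + 1) t)%:E =
   (bdry z n.+2%:R^-1 - bdry z n.+2%:R)%:E +
   z%:E * \int[mu]_(t in itv n) (Gamma_integrand z t)%:E)%E.
Proof.
move=> z0; set a : R := n.+2%:R^-1; set b : R := n.+2%:R.
have ab : a < b.
  rewrite /a /b; apply: (@lt_trans _ _ 1); rewrite ?invf_lt1 ?ltr1n //.
have pos t : t \in `[a, b] -> 0 < t.
  by move=> tab; apply: (@itvP n); exact: tab.
have poso t : t \in `]a, b[ -> 0 < t.
  move=> tab; apply: pos; move: tab; rewrite !in_itv /= => /andP[? ?].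
  by rewrite !ltW.
have dpow (w t : R) : 0 < t -> is_derive t 1 (fun s : R => s `^ w) (w * t `^ (w - 1)).
  by move=> t0; exact: is_derive1_powR.
have cpow (w t : R) : 0 < t -> {for t, continuous (fun s : R => s `^ w)}.
  move=> t0; apply: differentiable_continuous; apply/derivable1_diffP.
  by apply: ex_derive; exact: dpow.
have cexp : continuous (fun t : R => expR (- t)).
  move=> t; apply: continuous_comp; [exact: continuousN|exact: continuous_expR].
have dexp (t : R) : is_derive t 1 (fun s : R => - expR (- s)) (expR (- t)).
  by apply: is_derive_eq; rewrite mulrN1 opprK.
rewrite [LHS](_ : _ = \int[mu]_(t in `[a, b]) (t `^ z * expR (- t))%:E)%E; last first.
  by apply: eq_integral => t _; rewrite /Gamma_integrand addrK.
rewrite (@integration_by_parts R (fun t => t `^ z) (fun t => - expR (- t))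
  (fun t => z * t `^ (z - 1)) (fun t => expR (- t)) a b ab).
- rewrite -ge0_integralZl_EFin; last 4 first.
  + exact: measurable_itv.
  + by move=> t _; rewrite lee_fin Gamma_integrand_ge0.
  + by apply: measurable_Gamma_integrand; exact: measurable_itv.
  + exact: ltW.
  congr (_ + _)%E; first by rewrite /bdry; congr EFin; ring.
  rewrite -[RHS]oppeK -integral_ge0N; last first.
    by move=> t _; rewrite -EFinM lee_fin mulr_ge0 ?(ltW z0) ?Gamma_integrand_ge0.
  congr (- _)%E; apply: eq_integral => t _.
  by rewrite /Gamma_integrand -EFinM -EFinN; congr EFin; ring.
- apply: continuous_in_subspaceT => t /[!inE] tab.
  apply: cvgM; first exact: cvg_cst.
  exact: cpow (pos _ tab).
- split.
  + by move=> t tab; apply: ex_derive; exact: dpow (poso _ tab).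
  + by apply: cvg_at_right_filter; apply: cpow; apply: pos; rewrite in_itv /= lexx ltW.
  + by apply: cvg_at_left_filter; apply: cpow; apply: pos; rewrite in_itv /= lexx ltW.
- by move=> t /poso t0; rewrite powR_derive1 // in_itv /= andbT.
- exact: continuous_subspaceT.
- split.
  + by move=> t _; apply: ex_derive; exact: dexp.
  + by apply: cvg_at_right_filter; apply: cvgN; exact: cexp.
  + by apply: cvg_at_left_filter; apply: cvgN; exact: cexp.
- by move=> t _; rewrite derive1E; apply: derive_val; exact: dexp.
Qed.

Let cvg_inv_natSS : n.+2%:R^-1 @[n --> \oo] --> (0 : R).
Proof.
have := @cvg_harmonic R; rewrite -(cvg_shiftS (@harmonic R)) /harmonic /=; exact.
Qed.

Let bdry_cvg0 z : 0 < z -> bdry z n.+2%:R^-1 @[n --> \oo] --> 0.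
Proof.
move=> z0; have powc : n.+2%:R^-1 `^ z @[n --> \oo] --> (0 : R).
  have /cvg_at_rightP H := @powR_cvg0 R z z0.
  apply: (H (fun n => n.+2%:R^-1)); split => [n|]; first by rewrite invr_gt0.
  exact: cvg_inv_natSS.
have expc : expR (- n.+2%:R^-1) @[n --> \oo] --> (1 : R).
  have : expR (- n.+2%:R^-1) @[n --> \oo] --> expR (- (0 : R)).
    apply: continuous_cvg; first exact: continuous_expR.
    apply: cvgN; exact: cvg_inv_natSS.
  rewrite oppr0 expR0; exact.
have := cvgM powc expc; rewrite mul0r; exact.
Qed.

Let bdry_cvgy z : bdry z n.+2%:R @[n --> \oo] --> 0.
Proof.
pose N := (Num.truncn z).+1; have zN : z <= N%:R by rewrite ltW // truncnS_gt.
apply: (@squeeze_cvgr _ _ _ _ (fun=> 0) (fun n => N.+1`!%:R * n.+2%:R^-1)).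
- apply: nearW => n; rewrite /bdry mulr_ge0 ?powR_ge0 ?expR_ge0 //=.
  have n1 : 1 <= n.+2%:R :> R by rewrite ler1n.
  have n0 : 0 < n.+2%:R :> R by [].
  rewrite expRN ler_pdivrMr ?expR_gt0 //.
  apply: (@le_trans _ _ (n.+2%:R ^+ N)).
    by rewrite -powR_mulrn ?ler_powR // ltW.
  (* One term of the exponential series, of order one above [N >= z], leaves a bound of the form
     [(N + 1)! / t]. *)
  have := @expR_ge1Dxn R n.+2%:R N (ltW n0) => E.
  have {}E : n.+2%:R ^+ N.+1 <= N.+1`!%:R * expR (n.+2%:R : R).
    by rewrite -ler_pdivrMl ?ltr0n ?fact_gt0 // mulrC; lra.
  by rewrite mulrAC ler_pdivlMr // -exprSr.
- exact: cvg_cst.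
- rewrite -(mulr0 N.+1`!%:R); apply: cvgM; first exact: cvg_cst.
  exact: cvg_inv_natSS.
Qed.

Lemma Gamma_eintS z : 0 < z -> Gamma_eint (z + 1) = (z%:E * Gamma_eint z)%E.
Proof.
move=> z0; rewrite -[LHS](cvg_lim _ (@cvg_itv (z + 1))) //; apply: cvg_lim => //.
under eq_fun do rewrite itv_by_parts //.
have e0 : (bdry z n.+2%:R^-1 - bdry z n.+2%:R)%:E @[n --> \oo] --> 0%E.
  apply: cvg_EFin; first exact: nearW.
  have := cvgB (bdry_cvg0 z0) (@bdry_cvgy z); rewrite subrr; exact.
have zI : (z%:E * \int[mu]_(t in itv n) (Gamma_integrand z t)%:E)%E @[n --> \oo]
    --> (z%:E * Gamma_eint z)%E by exact: cvgeZl.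
have := cvgeD _ e0 zI; rewrite add0e; apply.
by rewrite fin_num_adde_defr.
Qed.

Lemma Gamma_eint1 : Gamma_eint 1 = 1%E.
Proof.
rewrite /Gamma_eint integral_itv_obnd_cbnd; last first.
  by apply: measurable_Gamma_integrand; exact: measurable_itv.
under eq_integral => t _ do rewrite /Gamma_integrand subrr powRr0 mul1r.
have cexp : continuous (fun t : R => expR (- t)).
  by move=> t; apply: continuous_comp; [exact: continuousN|exact: continuous_expR].
have dexp (t : R) : is_derive t 1 (fun s : R => - expR (- s)) (expR (- t)).
  by apply: is_derive_eq; rewrite mulrN1 opprK.
rewrite (@ge0_continuous_FTC2y R _ (fun t => - expR (- t)) 0 0).
- by rewrite oppr0 expR0 EFinN oppeK add0e.
- by move=> t _; exact: expR_ge0.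
- exact: continuous_subspaceT.
- rewrite -oppr0; apply: cvgN; exact: cvgr_expR.
- by move=> t _; apply: ex_derive; exact: dexp.
- by apply: cvg_at_right_filter; apply: cvgN; exact: cexp.
- by move=> t _; rewrite derive1E; apply: derive_val; exact: dexp.
Qed.

Lemma Gamma_eint_natS n : (Gamma_eint n.+1%:R < +oo)%E.
Proof.
elim: n => [|n IHn]; first by rewrite Gamma_eint1 ltry.
by rewrite -natr1 Gamma_eintS // lte_mul_pinfty // lee_fin.
Qed.

(** Passing to [z + 1] removes the singularity at [0]; there [t^z <= 1 + t^N] bounds the integral by
    its values at the integers [1] and [N + 1]. *)
Lemma Gamma_eint_lty z : 0 < z -> (Gamma_eint z < +oo)%E.
Proof.
move=> z0; suff : (Gamma_eint (z + 1) < +oo)%E.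
  rewrite Gamma_eintS //; case: (Gamma_eint z) (Gamma_eint_ge0 z) => [r _ _|_|//].
    by rewrite ltry.
  by rewrite mulry gtr0_sg // mul1e ltxx.
pose N := (Num.truncn z).+1; have zN : z <= N%:R by rewrite ltW // truncnS_gt.
have m0 : measurable (`]0%R, +oo[%classic : set R) by exact: measurable_itv.
apply: (@le_lt_trans _ _ (Gamma_eint 1 + Gamma_eint N.+1%:R)%E); last first.
  apply: lte_add_pinfty; first by rewrite Gamma_eint1 ltry.
  exact: Gamma_eint_natS.
rewrite /Gamma_eint -ge0_integralD //; last 4 first.
- by move=> t _; rewrite lee_fin Gamma_integrand_ge0.
- exact: measurable_Gamma_integrand.
- by move=> t _; rewrite lee_fin Gamma_integrand_ge0.
- exact: measurable_Gamma_integrand.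
apply: ge0_le_integral => //.
- by move=> t _; rewrite lee_fin Gamma_integrand_ge0.
- exact: measurable_Gamma_integrand.
- by apply: emeasurable_funD; exact: measurable_Gamma_integrand.
move=> t; rewrite /= in_itv /= andbT => t0.
rewrite -EFinD lee_fin /Gamma_integrand -mulrDl ler_wpM2r ?expR_ge0 //.
rewrite subrr powRr0 -natr1 !addrK powR_mulrn; last exact: ltW.
have [t1|/ltW t1] := leP t 1.
  apply: (@le_trans _ _ 1); last by rewrite lerDl exprn_ge0 // ltW.
  by rewrite -[leRHS](powRr0 t); apply: ger_powR; rewrite ?t0 //; exact: ltW.
apply: (@le_trans _ _ (t `^ N%:R)); first exact: ler_powR.
by rewrite powR_mulrn ?lerDr // ltW.
Qed.

(** At [z + 1] the integrand is at least [exp(-2)] on [[1, 2]]. *)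
Lemma Gamma_eint_gt0 z : 0 < z -> (0 < Gamma_eint z)%E.
Proof.
move=> z0; suff : (0 < Gamma_eint (z + 1))%E.
  rewrite Gamma_eintS // lt0e => /andP[zI0 _].
  rewrite lt0e Gamma_eint_ge0 andbT; apply: contraNneq zI0 => ->.
  by rewrite mule0.
have m12 : measurable (`[1%R, 2%R]%classic : set R) by exact: measurable_itv.
apply: (@lt_le_trans _ _ (\int[mu]_(t in `[1%R, 2%R]) (expR (- 2 : R))%:E)%E).
  have mu12 : mu `[1%R, 2%R]%classic = 1%E.
    by rewrite lebesgue_measure_itv /= lte_fin ltr1n -EFinB; congr EFin; lra.
  rewrite integral_cst // [X in (_ * X)%E](_ : _ = 1%E); last exact: mu12.
  by rewrite mule1 lte_fin expR_gt0.
apply: (@le_trans _ _ (\int[mu]_(t in `[1%R, 2%R]) (Gamma_integrand (z + 1) t)%:E)%E).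
  apply: ge0_le_integral => //.
    exact: measurable_Gamma_integrand.
  move=> t; rewrite /= in_itv /= => /andP[t1 t2].
  rewrite lee_fin /Gamma_integrand addrK -[leLHS]mul1r ler_pM ?expR_ge0 //.
    by rewrite -[leLHS](powRr0 t); apply: ler_powR => //; exact: ltW.
  by rewrite ler_expR lerN2.
apply: ge0_subset_integral => //.
- by apply: measurable_Gamma_integrand; exact: measurable_itv.
- by move=> t _; rewrite lee_fin Gamma_integrand_ge0.
- move=> t; rewrite /= !in_itv /= andbT => /andP[t1 _]; exact: lt_le_trans t1.
Qed.

Lemma Gamma_int_gt0 z : 0 < z -> 0 < Gamma_int z.
Proof. by move=> z0; rewrite fine_gt0 // Gamma_eint_gt0 ?Gamma_eint_lty. Qed.

Lemma Gamma_intS z : 0 < z -> Gamma_int (z + 1) = z * Gamma_int z.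
Proof.
have GE w : Gamma_int w = fine (Gamma_eint w) by [].
move=> z0; rewrite !GE Gamma_eintS // fineM //.
by rewrite ge0_fin_numE ?Gamma_eint_ge0 ?Gamma_eint_lty.
Qed.

Lemma hatnat_gt0 z : (forall m, z != - m%:R) -> 0 < z + (hatnat z)%:R.
Proof.
move=> znp; rewrite /hatnat.
have [f0|f0] := leP 0 (- Num.floor z).
  move: f0; case E : (- Num.floor z)%R => [m|//] _.
  rewrite lt0r; apply/andP; split; first by rewrite addr_eq0 znp.
  have : (Num.floor z)%:~R <= z by exact: floor_le_tmp.
  by rewrite -[Num.floor z]opprK E /= mulrNz; lra.
rewrite /= addr0 lt0r.
have := znp 0%N; rewrite oppr0 => -> /=.
by rewrite -floor_ge0; move: f0; rewrite oppr_lt0 => /ltW.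
Qed.

Lemma GammaS z : (forall m, z != - m%:R) -> Gamma (z + 1) = z * Gamma z.
Proof.
move=> znp; have z_neq0 : z != 0 by have := znp 0%N; rewrite oppr0.
have fl1 : Num.floor (z + 1) = Num.floor z + 1 by rewrite floorDrz ?rpred1 ?floor1.
have [z0|z0] := ltP 0 z.
  have h0 (y : R) : 0 < y -> hatnat y = 0%N.
    move=> y0; rewrite /hatnat max_r // oppr_le0 floor_ge0; exact: ltW.
  rewrite /Gamma !h0 ?addr_gt0 // !pochhammer0 !divr1 !addr0; exact: Gamma_intS.
have {}z0 : z < 0 by rewrite lt_neqAle z_neq0.
have hS : hatnat z = (hatnat (z + 1)).+1.
  rewrite /hatnat fl1; have : (Num.floor z < 0)%R by rewrite floor_lt0.
  by lia.
rewrite /Gamma hS pochhammerSl -natr1.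
have -> : z + ((hatnat (z + 1))%:R + 1) = z + 1 + (hatnat (z + 1))%:R by ring.
have p0 : pochhammer (z + 1) (hatnat (z + 1)) != 0.
  apply: pochhammer_neq0 => m.
  by apply: contra_neq (znp m.+1) => E; rewrite -natr1; lra.
by field; rewrite z_neq0 p0.
Qed.

Lemma GammaDn z n : (forall m, z != - m%:R) ->
  Gamma (z + n%:R) = pochhammer z n * Gamma z.
Proof.
move=> znp; elim: n => [|n IHn]; first by rewrite addr0 pochhammer0 mul1r.
rewrite -natr1 addrA GammaS => [|m]; last first.
  by apply: contra_neq (znp (n + m)%N) => E; rewrite natrD; lra.
by rewrite IHn pochhammerS; ring.
Qed.

(** [Gamma z] and [(z)_hat z] have the same sign; this is how the denominator in admissibility
    matches the Gamma factor of the exceptional weight. *)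
Lemma Gamma_hat_gt0 z : (forall m, z != - m%:R) ->
  0 < Gamma z * pochhammer z (hatnat z).
Proof.
move=> znp; rewrite /Gamma divfK ?pochhammer_neq0 //.
exact/Gamma_int_gt0/hatnat_gt0.
Qed.

End GammaFunction.

(** * Square-integrable functions for a discrete measure *)

Section DiscreteMeasure.
Context {R : realType} (w : nat -> {nonneg R}).
Implicit Types (f g : measurableTypeR R -> R).
Local Notation mu := (discrete_measure w).

Lemma measurable_horner (p : {poly R}) :
  measurable_fun setT (fun x : measurableTypeR R => p.[x]).
Proof.
elim/poly_ind: p => [|p k IHp].
  by under eq_fun do rewrite horner0; exact: measurable_cst.
under eq_fun do rewrite hornerMXaddC.
by apply: measurable_funD; [apply: measurable_funM|exact: measurable_cst].
Qed.

Lemma ge0_integral_discrete f : measurable_fun setT f -> (forall x, 0 <= f x) ->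
  (\int[mu]_x (f x)%:E = limn (EFin \o series (fun n => (w n)%:num * f n%:R)%R))%E.
Proof.
move=> mf f0; have mEf : measurable_fun setT (EFin \o f) by exact/measurable_EFinP.
rewrite ge0_integral_measure_series //; last by move=> x _; rewrite lee_fin.
congr (limn _); apply/funext => n /=; rewrite /series /= -sumEFin.
apply: eq_bigr => k _; rewrite ge0_integral_mscale //; last first.
  by move=> x _; rewrite lee_fin.
by rewrite integral_dirac // diracT mul1e EFinM.
Qed.

Lemma ge0_integral_discrete_cvg f (s : R) : measurable_fun setT f ->
  (forall x, 0 <= f x) ->
  series (fun n => (w n)%:num * f n%:R) @ \oo --> s ->
  (\int[mu]_x (f x)%:E = s%:E)%E.
Proof.
move=> mf f0 fs; rewrite ge0_integral_discrete // EFin_lim; last first.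
  by apply/cvg_ex; exists s.
by rewrite (cvg_lim _ fs).
Qed.

Lemma integrable_discrete f (s : R) : measurable_fun setT f ->
  series (fun n => (w n)%:num * `|f n%:R|) @ \oo --> s ->
  mu.-integrable setT (EFin \o f).
Proof.
move=> mf fs; apply/integrableP; split; first exact/measurable_EFinP.
under eq_integral do rewrite abse_EFin.
rewrite (ge0_integral_discrete_cvg _ _ fs) ?ltry //.
exact: measurableT_comp.
Qed.

(** A signed [f] is written as the difference of the nonnegative functions [f + |f|] and [|f|]. *)
Lemma integral_discrete_cvg f (s t : R) : measurable_fun setT f ->
  series (fun n => (w n)%:num * `|f n%:R|) @ \oo --> t ->
  series (fun n => (w n)%:num * f n%:R) @ \oo --> s ->
  (\int[mu]_x (f x)%:E = s%:E)%E.
Proof.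
move=> mf ft fs; pose g x := f x + `|f x|.
have mn : measurable_fun setT (fun x => `|f x|) by exact: measurableT_comp.
have mg : measurable_fun setT g by exact: measurable_funD.
have g0 x : 0 <= g x by rewrite /g; have := ler_norm (- f x); rewrite normrN; lra.
have gs : series (fun n => (w n)%:num * g n%:R) @ \oo --> s + t.
  rewrite (_ : (fun n => _) = (fun n => (w n)%:num * f n%:R) +
      (fun n => (w n)%:num * `|f n%:R|)).
    by rewrite seriesD; exact: cvgD.
  by apply/funext => n; exact: mulrDr.
transitivity (\int[mu]_x ((g x)%:E - (`|f x|)%:E))%E.
  by apply: eq_integral => x _; rewrite -EFinB /g addrK.
rewrite integralB //.
- rewrite (ge0_integral_discrete_cvg mg g0 gs).
  rewrite (ge0_integral_discrete_cvg mn _ ft) //.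
  by rewrite -EFinB addrK.
- apply: (@integrable_discrete g (s + t)) => //.
  by under eq_fun do rewrite (ger0_norm (g0 _)).
- apply: (@integrable_discrete _ t) => //.
  by under eq_fun do rewrite normr_id.
Qed.

Lemma Lnorm2_discrete f (s : R) : measurable_fun setT f ->
  series (fun n => (w n)%:num * f n%:R ^+ 2) @ \oo --> s ->
  ('N[mu]_(2%:E)[EFin \o f] = (Num.sqrt s)%:E)%E.
Proof.
move=> mf fs; rewrite unlock.
transitivity ((\int[mu]_x (f x ^+ 2)%:E) `^ 2^-1)%E.
  congr (_ `^ _)%E; apply: eq_integral => x _.
  by rewrite /= powR_mulrn // real_normK ?num_real.
have f20 x : 0 <= f x ^+ 2 by exact: sqr_ge0.
have E := ge0_integral_discrete_cvg (measurable_funX 2 mf) f20 fs.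
have s0 : 0 <= s by rewrite -lee_fin -E integral_ge0 // => x _; rewrite lee_fin.
by rewrite E poweR_EFin powR12_sqrt.
Qed.

Lemma Lfun2_discrete f : measurable_fun setT f ->
  cvgn (series (fun n => (w n)%:num * f n%:R ^+ 2)) -> f \in Lfun mu 2%:E.
Proof.
move=> mf /cvg_ex[s fs]; rewrite inE; apply/andP; split; rewrite inE //=.
by rewrite /finite_norm (Lnorm2_discrete mf fs) ltry.
Qed.

Lemma Lfun2_measurable f : f \in Lfun mu 2%:E -> measurable_fun setT f.
Proof. by rewrite inE => /andP[]; rewrite inE. Qed.

(** The finite integral of the square bounds the nondecreasing partial sums. *)
Lemma Lfun2_discrete_cvg f : f \in Lfun mu 2%:E ->
  cvgn (series (fun n => (w n)%:num * f n%:R ^+ 2)).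
Proof.
move=> fL; have mf := Lfun2_measurable fL.
have /integrableP[_] := Lfun2_integrable_sqr fL.
under eq_integral do rewrite /= ger0_norm ?sqr_ge0 //.
rewrite ge0_integral_discrete; last 2 first.
- exact: measurable_funX.
- by move=> x; exact: sqr_ge0.
set u := series _.
have ndu : nondecreasing_seq u.
  by apply: nondecreasing_series => n _ _; rewrite mulr_ge0 ?sqr_ge0.
have ndEu : nondecreasing_seq (EFin \o u) by move=> m n mn; rewrite lee_fin ndu.
rewrite (cvg_lim _ (ereal_nondecreasing_cvgn ndEu)) // => sup_lty.
have ub n : ((u n)%:E <= ereal_sup (range (EFin \o u)))%E.
  by apply: ereal_sup_ubound; exists n.
apply: nondecreasing_is_cvgn => //.
exists (fine (ereal_sup (range (EFin \o u)))) => _ [n _ <-].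
rewrite -lee_fin fineK //; rewrite ge0_fin_numE //; apply: le_trans (ub 0%N).
by rewrite lee_fin /u /series /= big_geq.
Qed.

End DiscreteMeasure.

(** * Exceptional Meixner polynomials *)

Section ExceptionalMeixner.
Context {R : realType} (a c : R) (F1 F2 : {fset nat}).
Hypotheses (a_gt0 : 0 < a) (a_lt1 : a < 1) (c_np : forall m : nat, c != - m%:R).
Let a_neq0 : a != 0. Proof. by rewrite gt_eqF. Qed.
Let a_neq1 : a != 1. Proof. by rewrite lt_eqF. Qed.
Let Ba1 : 1 - a != 0. Proof. by rewrite subr_eq0 eq_sym. Qed.

Local Notation k1 := (#|` F1|)%N.
Local Notation k2 := (#|` F2|)%N.
Local Notation k := (#|` F1| + #|` F2|)%N.
Local Notation s1 := (sort leq F1).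
Local Notation s2 := (sort leq F2).
Local Notation K := (dualmeixner a c).

Definition seednode (i : nat) : R :=
  if (i < k1)%N then (nth 0%N s1 i)%:R else - c - (nth 0%N s2 (i - k1))%:R.

Definition seedscale (i x : nat) : R :=
  if (i < k1)%N
  then let f := nth 0%N s1 i in (a / (a - 1)) ^+ f * pochhammer c f / f`!%:R
  else let f := nth 0%N s2 (i - k1) in
    a ^+ x * ((1 - a) ^- f * pochhammer c f / f`!%:R).

Local Notation t := (fun i : 'I_k => seednode i).

(** In an [F2] row the factor [a^-j] cancels the [a^j] coming from [a^(x + j)], so the scale is
    constant along the row and leaves the determinant. *)
Lemma horner_entryF i j x :
  (entryF a c F1 F2 i j).[x%:R] = seedscale i x * (K (x + j)).[seednode i].
Proof.
rewrite /entryF /seedscale /seednode; case: ifP => _ /=.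
  rewrite /shiftpoly horner_comp hornerD hornerX hornerC -natrD meixner_dualE //.
  by rewrite dualmeixner_sym.
rewrite /shiftpoly hornerZ horner_comp hornerD hornerX hornerC -natrD.
rewrite meixner_inv_dualE // exprD.
have aj : a ^+ j != 0 by rewrite expf_neq0.
set z := _ / _; move: (_.[_]) => y; rewrite -!mulrA mulrCA mulKf //.
Qed.

(** A coincidence [f = - c - g] between the two kinds of nodes would make [c] the excluded value
    [- (f + g)]. *)
Lemma seednode_inj : injective t.
Proof.
have sz1 : size s1 = k1 by rewrite size_sort.
have sz2 : size s2 = k2 by rewrite size_sort.
have u1 : uniq s1 by rewrite sort_uniq fset_uniq.
have u2 : uniq s2 by rewrite sort_uniq fset_uniq.
have mixed (f g : nat) : f%:R <> - c - g%:R :> R.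
  by move=> fg; have /eqP := c_np (f + g); apply; rewrite natrD; lra.
move=> i j; rewrite /seednode; case: ifPn => ik; case: ifPn => jk.
- move/eqP; rewrite eqr_nat nth_uniq ?sz1 // => /eqP; exact: val_inj.
- by move/mixed.
- by move/esym/mixed.
rewrite -!leqNgt in ik jk.
move/addrI/oppr_inj/eqP; rewrite eqr_nat nth_uniq ?sz2 ?ltn_subLR // => /eqP ij.
by apply: val_inj; rewrite /= -(subnK ik) ij subnK.
Qed.

Definition rowscale (x : nat) : R := \prod_(i < k) seedscale i x.

(** This is [a] to the power [k2]: only the [F2] rows have a scale depending on [x]. *)
Definition rowratio : R := \prod_(i < k) (if (i < k1)%N then 1 else a).

Lemma rowratio_gt0 : 0 < rowratio.
Proof. by apply: prodr_gt0 => i _; case: ifP. Qed.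

Lemma rowscaleS x : rowscale x.+1 = rowscale x * rowratio.
Proof.
rewrite /rowscale /rowratio -big_split; apply: eq_bigr => i _ /=.
by rewrite /seedscale; case: ifP => _; rewrite ?mulr1 // exprS; ring.
Qed.

Lemma rowscale_neq0 x : rowscale x != 0.
Proof.
apply/prodf_neq0 => i _; rewrite /seedscale; case: ifP => _ /=.
  rewrite !mulf_neq0 ?expf_neq0 ?mulf_neq0 ?invr_neq0 ?pochhammer_neq0 ?fact_neq0 //.
  by rewrite subr_eq0.
by rewrite !mulf_neq0 ?invr_neq0 ?expf_neq0 ?pochhammer_neq0 ?fact_neq0.
Qed.

Lemma det_mulrow n (s : 'I_n -> R) (A : 'M[R]_n) :
  \det (\matrix_(i, j) (s i * A i j)) = (\prod_i s i) * \det A.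
Proof.
rewrite (_ : \matrix_(i, j) _ = diag_mx (\row_i s i) *m A).
  by rewrite det_mulmx det_diag; congr (_ * _); apply: eq_bigr => i _; rewrite mxE.
by apply/matrixP => i j; rewrite mul_diag_mx !mxE.
Qed.

Lemma horner_det n (A : 'M[{poly R}]_n) y :
  (\det A).[y] = \det (map_mx (horner_eval y) A).
Proof. by rewrite det_map_mx. Qed.

Lemma horner_OmegaF x :
  (OmegaF a c F1 F2).[x%:R] = rowscale x * casoratian K t x.
Proof.
rewrite /OmegaF horner_det -det_mulrow; congr (\det _).
by apply/matrixP => i j; rewrite !mxE /horner_eval horner_entryF.
Qed.

Lemma horner_meixnerF n x : (meixnerF a c F1 F2 (uF F1 F2 + n)).[x%:R] =
  (a / (a - 1)) ^+ n * pochhammer c n / n`!%:R * rowscale x *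
  (christoffel K t x).[n%:R].
Proof.
pose sc (i : 'I_k.+1) : R := if unlift ord0 i is Some i' then seedscale i' x
  else (a / (a - 1)) ^+ n * pochhammer c n / n`!%:R.
have -> : (a / (a - 1)) ^+ n * pochhammer c n / n`!%:R * rowscale x = \prod_i sc i.
  rewrite big_ord_recl /sc unlift_none; congr (_ * _).
  by apply: eq_bigr => i _; rewrite liftK.
rewrite horner_christoffel -det_mulrow /meixnerF horner_det; congr (\det _).
apply/matrixP => i j; rewrite !mxE /horner_eval /sc.
have [i' ->|->] := unliftP ord0 i.
  by rewrite /= horner_entryF.
rewrite /= addKn /shiftpoly horner_comp hornerD hornerX hornerC -natrD.
by rewrite meixner_dualE // dualmeixner_sym.
Qed.

Lemma horner_seedpoly (y : R) : (nodepoly t).[y] =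
  (\prod_(f <- F1) (y - f%:R)) * (\prod_(f <- F2) (y + c + f%:R)).
Proof.
have perm1 : perm_eq F1 s1 by rewrite perm_sym perm_sort.
have perm2 : perm_eq F2 s2 by rewrite perm_sym perm_sort.
rewrite (perm_big _ perm1) (perm_big _ perm2) /= horner_prod big_split_ord /=.
rewrite (big_nth 0%N) [X in _ = _ * X](big_nth 0%N) !size_sort !big_mkord.
congr (_ * _); apply: eq_bigr => i _; rewrite !hornerE /seednode /=.
  by rewrite ltn_ord.
by rewrite ltnNge leq_addr /= addKn; ring.
Qed.

(** * The Krall-Meixner weight and its orthogonal polynomials *)

Hypothesis adm : admissible c F1 F2.

Let chat : R := pochhammer c (hatnat c).
Let chat_neq0 : chat != 0. Proof. exact: pochhammer_neq0. Qed.
Let u : nat -> R := meixnerw a c.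
Let u_decay : expdecay u. Proof. exact: meixnerw_decay. Qed.
Let P : {poly R} := chat^-1 *: nodepoly t.

(* The Krall-Meixner weight, divided by [(c)_hat c] to make it nonnegative. *)
Definition krallw (n : nat) : R := P.[n%:R] * u n.

(** The identity [(c)_n (n + c)_hat c = (c)_hat c (c + hat c)_n] separates the quotient in
    [admissible] from a Meixner weight with the positive parameter [c + hat c]. *)
Let krallwE n : krallw n =
  (nodepoly t).[n%:R] / pochhammer (n%:R + c) (hatnat c) *
  (a ^+ n * pochhammer (c + (hatnat c)%:R) n / n`!%:R).
Proof.
have E : pochhammer c n * pochhammer (n%:R + c) (hatnat c) =
    chat * pochhammer (c + (hatnat c)%:R) n.
  by rewrite [n%:R + c]addrC -!pochhammerD addnC.
have p0 : pochhammer (n%:R + c) (hatnat c) != 0.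
  apply: pochhammer_neq0 => m; apply: contra_neq (c_np (n + m)%N) => nc.
  by rewrite natrD; lra.
rewrite /krallw /P hornerZ /u /meixnerw.
rewrite (_ : pochhammer c n = chat * pochhammer (c + (hatnat c)%:R) n /
  pochhammer (n%:R + c) (hatnat c)); last by rewrite -E mulfK.
by field; rewrite chat_neq0 p0 fact_neq0.
Qed.

Let krallw_ge0 n : 0 <= krallw n.
Proof.
rewrite krallwE; apply: mulr_ge0; first by rewrite horner_seedpoly; exact: adm.
rewrite divr_ge0 // mulr_ge0 ?exprn_ge0 ?(ltW a_gt0) //.
exact/pochhammer_ge0/ltW/hatnat_gt0.
Qed.

Let krallw_decay : expdecay krallw.
Proof. exact: expdecay_poly. Qed.

Let u_neq0 n : u n != 0.
Proof.
by rewrite /u /meixnerw !mulf_neq0 ?invr_neq0 ?expf_neq0 ?pochhammer_neq0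
  ?fact_neq0.
Qed.

Let krallw_gt0 n : n \notin F1 -> 0 < krallw n.
Proof.
move=> nF1; rewrite lt0r krallw_ge0 andbT mulf_neq0 ?u_neq0 // /P hornerZ.
rewrite mulf_neq0 ?invr_neq0 // horner_seedpoly mulf_neq0 //.
  rewrite prodf_seq_neq0; apply/allP => f fF1 /=; rewrite subr_eq0 eqr_nat.
  by apply: contraNneq nF1 => ->.
rewrite prodf_seq_neq0; apply/allP => f _ /=; apply: contra_neq (c_np (n + f)%N) => nc.
by rewrite natrD; lra.
Qed.

(** [p * P] has finitely many roots, so some natural number contributes a strictly positive term. *)
Let krall_pos (p : {poly R}) : p != 0 -> 0 < momentfun u (p * p * P).
Proof.
move=> p0; have P0 : P != 0.
  by rewrite scaler_eq0 invr_eq0 negb_or chat_neq0 monic_neq0 ?monic_nodepoly.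
have pP0 : p * P != 0 by rewrite mulf_neq0.
have [n pPn] : exists n : nat, (p * P).[n%:R] != 0.
  apply: contrapT => allroot.
  have := @max_poly_roots _ _ [seq n%:R | n <- iota 0 (size (p * P))] pP0.
  rewrite size_map size_iota ltnn => /(_ _ _)/notF; apply.
    apply/allP => _ /mapP[n _ ->]; apply/rootP/eqP/negPn/negP => n0.
    by apply: allroot; exists n.
  by rewrite map_inj_uniq ?iota_uniq // => m n /eqP; rewrite eqr_nat => /eqP.
move: pPn; rewrite hornerM mulf_eq0 negb_or => /andP[pn Pn].
apply: (momentfun_sqr_gt0 u_decay krallw_ge0 _ pn).
by rewrite lt0r krallw_ge0 andbT mulf_neq0 ?u_neq0.
Qed.

Let kappa (i : nat) : R := nsum u * (-1) ^+ i * i`!%:R / (1 - a) ^+ i.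

Let sizeK j : size (K j) = j.+1. Proof. exact: size_dualmeixner. Qed.

Let orthoK i (q : {poly R}) : (size q <= i.+1)%N ->
  momentfun u (K i * q) = q`_i * kappa i.
Proof. exact: momentfun_dualmeixner. Qed.

Let nodepoly_def (p : {poly R}) : p != 0 -> momentfun u (p * p * nodepoly t) != 0.
Proof.
move=> /krall_pos; rewrite /P -scalerAr (momentfunZ u_decay) => /lt0r_neq0.
by rewrite mulf_eq0 negb_or => /andP[].
Qed.

Local Notation W := (casoratian K t).
Local Notation B := (christoffelq K t).

Lemma casoratian_meixner_neq0 x : W x != 0.
Proof. exact: (casoratian_neq0 sizeK seednode_inj u_decay orthoK nodepoly_def). Qed.

Let sizeB x : size (B x) = x.+1.
Proof. exact/(size_christoffelq sizeK)/casoratian_meixner_neq0. Qed.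

Let N (x : nat) : R := chat^-1 * ((-1) ^+ k * W x * W x.+1 *
  (K (x + k))`_(x + k) * kappa x).

Let orthoB x y : momentfun krallw (B x * B y) = if x == y then N x else 0.
Proof.
rewrite /krallw momentfun_weightM mulrC /P -scalerAr (momentfunZ u_decay).
rewrite (momentfun_christoffelq sizeK seednode_inj u_decay orthoK nodepoly_def).
by case: eqP => _; rewrite ?mulr0.
Qed.

(** The explicit formula hides its sign; positivity comes from [N x] being a squared norm, and it
    fixes the sign of the product of consecutive Casorati determinants. *)
Let N_gt0 x : 0 < N x.
Proof.
have := orthoB x x; rewrite eqxx => <-.
rewrite /krallw momentfun_weightM mulrC; apply: krall_pos.
by rewrite -size_poly_eq0 sizeB.
Qed.

Let krall_dense n (e : R) : 0 < e -> exists q, indicator_err krallw n q < e.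
Proof.
move=> e0; have [M [C [M0 C0 PM]]] := poly_meixnerw_le a_gt0 P c.
have [||||q qe] := @meixner_dense R a M%:R n (e / C) => //.
- by rewrite ltr0n.
- exact: divr_gt0.
exists q; apply: (@le_lt_trans _ _ (C * indicator_err (meixnerw a M%:R) n q)).
  apply: indicator_err_le => //; first exact: meixnerw_decay.
  by move=> m; apply: le_trans (ler_norm _) (PM m).
by rewrite mulrC -ltr_pdivlMr.
Qed.

Let cvg_dual n m : 0 < krallw m ->
  series (fun x => krallw n * (B x).[n%:R] * (B x).[m%:R] / N x) @ \oo -->
    ((m == n)%:R : R).
Proof.
apply: (cvg_dual_orthogonality krallw_decay krallw_ge0 sizeB N_gt0 orthoB).
exact: krall_dense.
Qed.

(** The factors independent of [x]: [Gamma c] is left by [GammaDn], [chat] by the normalisation of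
    the Krall-Meixner weight, [nsum u] by the Meixner norm, the powers of [1 - a] and [a] by the
    leading coefficient of [K_(x+k)], and [rowratio] by [Omega(x + 1)]. *)
Let A : R := Gamma c / chat * nsum u * ((1 - a) ^+ k / (a ^+ k * rowratio)).

Let A_gt0 : 0 < A.
Proof.
have G0 : 0 < Gamma c / chat.
  have c2 : 0 < chat ^+ 2 by rewrite exprn_even_gt0.
  rewrite -(pmulr_lgt0 _ c2) expr2 mulrA divfK //; exact: Gamma_hat_gt0.
have S0 : 0 < nsum u by exact: nsum_meixnerw_gt0.
have q0 : 0 < (1 - a) ^+ k / (a ^+ k * rowratio).
  by rewrite divr_gt0 ?mulr_gt0 ?exprn_gt0 ?rowratio_gt0 ?subr_gt0.
exact: mulr_gt0 (mulr_gt0 G0 S0) q0.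
Qed.

Lemma weightFE x : weightF a c F1 F2 x = A / (rowscale x ^+ 2 * N x).
Proof.
rewrite /weightF.
have -> : x%:R + 1 = x.+1%:R :> R by rewrite natr1.
rewrite !horner_OmegaF rowscaleS.
have -> : x%:R + c + k%:R = c + (x + k)%:R by rewrite natrD; ring.
rewrite GammaDn // /N /kappa /A coef_dualmeixner //.
have -> : (1 - a^-1) ^+ (x + k) = (-1) ^+ k * (-1) ^+ x *
    ((1 - a) ^+ x * (1 - a) ^+ k / (a ^+ x * a ^+ k)).
  rewrite -!exprD -expr_div_n addnC -exprMn addnC; congr (_ ^+ _); field.
  exact: a_neq0.
have sk : (-1) ^+ k != 0 :> R by rewrite expf_neq0 // oppr_eq0 oner_eq0.
have sx : (-1) ^+ x != 0 :> R by rewrite expf_neq0 // oppr_eq0 oner_eq0.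
have sk2 : (-1) ^+ k * (-1) ^+ k = 1 :> R by rewrite -exprMn mulrNN mulr1 expr1n.
have sx2 : (-1) ^+ x * (-1) ^+ x = 1 :> R by rewrite -exprMn mulrNN mulr1 expr1n.
have W0 := casoratian_meixner_neq0 x; have W1 := casoratian_meixner_neq0 x.+1.
have S0 : nsum u != 0 by rewrite gt_eqF // nsum_meixnerw_gt0.
have D0 : rowratio != 0 by rewrite gt_eqF // rowratio_gt0.
have r0 := rowscale_neq0 x.
have p0 : pochhammer c (x + k) != 0 by exact: pochhammer_neq0.
have ax : a ^+ x != 0 by rewrite expf_neq0.
have ak : a ^+ k != 0 by rewrite expf_neq0.
have bx : (1 - a) ^+ x != 0 by rewrite expf_neq0.
have bk : (1 - a) ^+ k != 0 by rewrite expf_neq0.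
have f0 : x`!%:R != 0 :> R by exact: fact_neq0.
have -> : chat^-1 * ((-1) ^+ k * W x * W x.+1 *
    ((-1) ^+ k * (-1) ^+ x * ((1 - a) ^+ x * (1 - a) ^+ k / (a ^+ x * a ^+ k)) /
      pochhammer c (x + k)) * (nsum u * (-1) ^+ x * x`!%:R / (1 - a) ^+ x)) =
  chat^-1 * (W x * W x.+1 * ((1 - a) ^+ k / (a ^+ x * a ^+ k) /
    pochhammer c (x + k)) * (nsum u * x`!%:R)).
  move: sk2 sx2; move: ((-1) ^+ k) ((-1) ^+ x) => ek ex ek2 ex2.
  set rhs := (X in _ = X).
  transitivity (ek * ek * (ex * ex) * rhs); last by rewrite ek2 ex2 !mul1r.
  rewrite /rhs.
  by field; rewrite chat_neq0 ax ak bx p0.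
by field; rewrite ?W0 ?W1 ?S0 ?D0 ?r0 ?p0 ?ax ?ak ?bk ?f0 ?chat_neq0.
Qed.

Lemma weightF_gt0 x : 0 < weightF a c F1 F2 x.
Proof.
rewrite weightFE divr_gt0 // mulr_gt0 // lt0r sqr_ge0 andbT expf_neq0 //.
exact: rowscale_neq0.
Qed.

(** * Both orthogonality relations of the exceptional polynomials *)

Let gam (n : nat) : R := (a / (a - 1)) ^+ n * pochhammer c n / n`!%:R.

Let gam_neq0 n : gam n != 0.
Proof.
by rewrite /gam !mulf_neq0 ?expf_neq0 ?mulf_neq0 ?invr_neq0 ?pochhammer_neq0 ?fact_neq0
  ?subr_eq0.
Qed.

Local Notation M n x := ((meixnerF a c F1 F2 (uF F1 F2 + n)).[x%:R]).

Let ME n x : M n x = gam n * rowscale x * ((B x).[n%:R] * (nodepoly t).[n%:R]).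
Proof.
rewrite horner_meixnerF -(christoffelqK K seednode_inj) hornerM; congr (_ * _).
Qed.

Let J (n : nat) := n \notin F1.

(** Read off from dual orthogonality on the diagonal, where the sum over [x] of [R_x(n)^2 / N x] is
    [1 / krallw n]. *)
Definition sqnormF n : R := A * (gam n * (nodepoly t).[n%:R]) ^+ 2 / krallw n.

Let seedpoly_neq0 n : J n -> (nodepoly t).[n%:R] != 0.
Proof.
move=> /krallw_gt0 /lt0r_neq0; rewrite /krallw mulf_eq0 negb_or => /andP[+ _].
by rewrite /P hornerZ mulf_eq0 negb_or => /andP[].
Qed.

Lemma sqnormF_gt0 n : J n -> 0 < sqnormF n.
Proof.
move=> Jn; rewrite /sqnormF divr_gt0 ?krallw_gt0 // mulr_gt0 //.
by rewrite lt0r sqr_ge0 andbT expf_neq0 // mulf_neq0 // seedpoly_neq0.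
Qed.

Lemma meixnerF_orthogonality n m : J n -> J m ->
  series (fun x => weightF a c F1 F2 x * (M n x * M m x)) @ \oo -->
    if n == m then sqnormF n else 0.
Proof.
move=> Jn Jm; set q := fun n : nat => (nodepoly t).[n%:R].
have kn : krallw n != 0 by rewrite gt_eqF // krallw_gt0.
have -> : (if n == m then sqnormF n else 0) =
    A * (gam n * q n) * (gam m * q m) / krallw n * (m == n)%:R.
  rewrite eq_sym; case: eqP => [->|_]; last by rewrite mulr0.
  by rewrite mulr1 /sqnormF /q; ring.
rewrite (_ : (fun x => _) = fun x => A * (gam n * q n) * (gam m * q m) / krallw n *
    (krallw n * (B x).[n%:R] * (B x).[m%:R] / N x)).
  by apply: cvg_seriesZ; apply: cvg_dual; exact: krallw_gt0.
apply/funext => x; rewrite weightFE !ME -/(q n) -/(q m).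
have r0 := rowscale_neq0 x; have N0 := lt0r_neq0 (N_gt0 x).
by field; rewrite r0 N0 kn.
Qed.

(** After cancellation of the factors depending on [n] alone, this is the orthogonality of [R_y] and
    [R_z] for the Krall-Meixner weight. *)
Lemma meixnerF_dual_orthogonality y z :
  series (fun n => if J n then M n y * M n z / sqnormF n else 0) @ \oo -->
    if y == z then (weightF a c F1 F2 y)^-1 else 0.
Proof.
have A0 := lt0r_neq0 A_gt0.
have -> : (if y == z then (weightF a c F1 F2 y)^-1 else 0) =
    rowscale y * rowscale z / A * momentfun krallw (B y * B z).
  rewrite orthoB; case: eqP => [<-|_]; last by rewrite mulr0.
  have r0 := rowscale_neq0 y; have N0 := lt0r_neq0 (N_gt0 y).
  by rewrite weightFE; field; rewrite r0 N0 A0.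
rewrite (_ : (fun n => _) = fun n => rowscale y * rowscale z / A *
    ((B y * B z).[n%:R] * krallw n)).
  by apply: cvg_seriesZ; exact: (momentfun_cvg krallw_decay).
apply/funext => n; rewrite hornerM; case: ifPn => Jn.
  have q0 := seedpoly_neq0 Jn; have g0 := gam_neq0 n.
  have k0 := lt0r_neq0 (krallw_gt0 Jn).
  by rewrite !ME /sqnormF; field; rewrite q0 g0 k0 A0.
(* At the omitted indices the Krall-Meixner weight vanishes, so the sum over [J] equals the full
   moment series. *)
rewrite /krallw /P hornerZ horner_seedpoly (_ : \prod_(f <- F1) _ = 0).
  by rewrite !(mul0r, mulr0).
apply/eqP; rewrite prodf_seq_eq0; apply/hasP; exists n; first by move/negPn: Jn.
by rewrite /= subrr.
Qed.

End ExceptionalMeixner.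

Theorem theorem4p4 (R : realType) (a c : R) (F1 F2 : {fset nat})
    (a_gt0 : 0 < a) (a_lt1 : a < 1)
    (c_nonpole : forall m : nat, c != - m%:R)
    (F1_pos : forall f : nat, f \in F1 -> (0 < f)%N)
    (F2_pos : forall f : nat, f \in F2 -> (0 < f)%N)
    (F_nonempty : ~ (F1 = fset0 /\ F2 = fset0))
    (adm : admissible c F1 F2) :
  (forall x : nat, (OmegaF a c F1 F2).[x%:R] != 0) /\
  exists w : nat -> {nonneg R},
    [/\ (forall x : nat, (w x)%:num = weightF a c F1 F2 x),
        in_L2 (discrete_measure w) (sigmaF F1 F2) (meixnerF a c F1 F2),
        dense_span_L2 (discrete_measure w) (sigmaF F1 F2)
          (meixnerF a c F1 F2)
      & orthogonal_polys (discrete_measure w) (sigmaF F1 F2)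
          (meixnerF a c F1 F2)].
Proof.
have a_neq0 : a != 0 by rewrite gt_eqF.
have a_neq1 : a != 1 by rewrite lt_eqF.
have w_gt0 := weightF_gt0 a_gt0 a_lt1 c_nonpole adm.
have ortho := meixnerF_orthogonality a_gt0 a_lt1 c_nonpole adm.
have sq_gt0 := sqnormF_gt0 a_gt0 a_lt1 c_nonpole adm.
split.
  move=> x; rewrite horner_OmegaF // mulf_neq0 ?rowscale_neq0 //.
  exact: casoratian_meixner_neq0.
exists (fun x => NngNum (ltW (w_gt0 x))).
set w := fun x => NngNum _.
have sigmaE n : sigmaF F1 F2 n -> exists2 m, m \notin F1 & n = (uF F1 F2 + m)%N.
  move=> [un nF]; exists (n - uF F1 F2)%N; last by rewrite subnKC.
  by apply/negP => nF1; apply: nF; exists (n - uF F1 F2)%N; rewrite //= subnKC.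
have L2 n : sigmaF F1 F2 n ->
    (fun x : measurableTypeR R => (meixnerF a c F1 F2 n).[x]) \in
      Lfun (discrete_measure w) 2%:E.
  move=> /sigmaE[m mF1 ->]; apply: Lfun2_discrete; first exact: measurable_horner.
  by apply/cvg_ex; eexists; exact: (ortho m m mF1 mF1).
split => //.
- move=> f fL e e0; have mf := Lfun2_measurable fL.
  (* [dual_density] controls the square of the norm. *)
  have e20 : 0 < e ^+ 2 by rewrite exprn_gt0.
  have [M [b [s [se cs]]]] := dual_density w_gt0 sq_gt0 ortho
    (meixnerF_dual_orthogonality a_gt0 a_lt1 c_nonpole adm)
    (Lfun2_discrete_cvg fL) e20.
  exists [seq (uF F1 F2 + n)%N | n <- index_iota 0 M & n \notin F1].
  exists (fun n => b (n - uF F1 F2)%N); split.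
    move=> _ /mapP[n + ->]; rewrite mem_filter => /andP[nF1 _].
    split; first exact: leq_addr.
    by move=> [m mF1 /eqP]; rewrite eqn_add2l => /eqP mn; rewrite -mn mF1 in nF1.
  rewrite (@Lnorm2_discrete _ _ _ s).
  + rewrite lte_fin -[ltRHS]ger0_norm ?(ltW e0) // -sqrtr_sqr.
    by rewrite ltr_sqrt.
  + apply: measurable_funB => //; exact: measurable_horner.
  + rewrite (_ : (fun n => _) = fun x => weightF a c F1 F2 x *
        (f x%:R - \sum_(n < M | val n \notin F1)
           b n * (meixnerF a c F1 F2 (uF F1 F2 + n)).[x%:R]) ^+ 2) //.
    apply/funext => x; congr (_ * (_ - _) ^+ 2).
    rewrite horner_sum big_map big_filter big_mkord.
    by apply: eq_bigr => n _; rewrite hornerZ addKn.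
- split.
    move=> n m /sigmaE[n' nF1 ->] /sigmaE[m' mF1 ->] nm.
    have {}nm : n' != m' by apply: contra_notN nm => /eqP ->.
    pose p := meixnerF a c F1 F2 (uF F1 F2 + n').
    pose q := meixnerF a c F1 F2 (uF F1 F2 + m').
    have mpq : measurable_fun setT (fun x : measurableTypeR R => p.[x] * q.[x]).
      by apply: measurable_funM; exact: measurable_horner.
    have cp := ortho n' n' nF1 nF1; have cq := ortho m' m' mF1 mF1.
    (* Absolute convergence, needed to integrate the signed product, follows from
       [|p q| <= p^2 + q^2] and the two norm series. *)
    have [t ct] : exists t : R,
        series (fun x => (w x)%:num * `|p.[x%:R] * q.[x%:R]|) @ \oo --> t.
      apply/cvg_ex; apply: (@series_le_cvg _ _
          ((fun x => (w x)%:num * (p.[x%:R] * p.[x%:R])) +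
          (fun x => (w x)%:num * (q.[x%:R] * q.[x%:R])))).
      * by move=> x; rewrite mulr_ge0.
      * by move=> x; apply: addr_ge0; rewrite mulr_ge0 // -expr2 sqr_ge0.
      * move=> x; rewrite [leRHS](_ : _ = (w x)%:num * (p.[x%:R] ^+ 2 + q.[x%:R] ^+ 2)).
          rewrite ler_wpM2l // ler_norml; apply/andP.
          by split; nra.
        by rewrite mulrDr !expr2.
      * by apply: is_cvg_seriesD; apply/cvg_ex; eexists; [exact: cp|exact: cq].
    have := ortho n' m' nF1 mF1; rewrite (negPf nm) => c0.
    exact: (integral_discrete_cvg mpq ct c0).
  move=> n /sigmaE[m mF1 ->].
  have mp : measurable_fun setT
      (fun x : measurableTypeR R => (meixnerF a c F1 F2 (uF F1 F2 + m)).[x] ^+ 2).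
    by apply: measurable_funX; exact: measurable_horner.
  rewrite (@ge0_integral_discrete_cvg _ _ _ (sqnormF a c F1 F2 m) mp).
  + by rewrite eqe gt_eqF // sq_gt0.
  + by move=> x; exact: sqr_ge0.
  + by have := ortho m m mF1 mF1; rewrite eqxx.
Qed.
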